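(* Let $n\ge 1$, let $\lambda$ be an $n$-partition and let $\pi\in S_n^\lambda$. Then the atom $c_\lambda(\pi;x)$ is the sum of the weight monomials $x^T$ over all $T\in\mathcal{T}_\lambda$ such that $T(l,k)\in C_\lambda(T,\pi;l,k)$ for all $(l,k)\in\lambda$.
   Context: Notation. Fix $n\ge 1$. For integers $p,q$, $[p,q]=\{p,p+1,\dots,q\}$ (empty if $p>q$). An $n$-partition is $\lambda=(\lambda_1\ge\dots\ge\lambda_n\ge 0)$, integers. Its shape has $\lambda_i$ left-justified boxes in row $i$ (row 1 at the top). The box in column $j$ and row $i$ is written $(j,i)\in\lambda$ (column index first). The column lengths are $\zeta_1,\dots,\zeta_{\lambda_1}$. A semistandard tableau $T$ of shape $\lambda$ is a filling with values $T(j,i)\in[1,n]$ such that $T(j,i)\le T(j+1,i)$ and $T(j,i)<T(j,i+1)$; $\mathcal{T}_\lambda$ is the set of these. Boundary conventions: $T(l+1,k):=n$ if $l=\lambda_k$; $T(l,k+1):=n+1$ if $k=\zeta_l$. $m(T)$ is the maximum of the values at the bottoms of the columns of $T$ (equivalently the maximum value of $T$); for the empty tableau, $m:=1$. The weight monomial of $T$ is $x^T:=\prod_{i=1}^n x_i^{c_i}$, where $c_i$ is the number of values of $T$ equal to $i$. Permutations and keys. $S_n$ is the set of $n$-tuples $\pi=(\pi_1,\dots,\pi_n)$ with distinct entries from $[1,n]$. Let $q_1<\dots<q_r$ be the distinct column lengths of $\lambda$, $q_0:=0$, $q_{r+1}:=n$. $S_n^\lambda$ is the set of $\pi\in S_n$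 such that $\pi_i<\pi_j$ whenever $i<j$ both lie in $[q_{s-1}+1,q_s]$ for some $1\le s\le r+1$. The $\lambda$-key $Y=Y_\lambda(\pi)$ is the tableau of shape $\lambda$ whose $j$th column consists of $\pi_1,\dots,\pi_{\zeta_j}$ sorted increasingly from top to bottom, with entries $Y(j,i)$. Atom. For $1\le i\le n-1$, $s_i.\pi$ is obtained from $\pi\in S_n$ by interchanging the values $i$ and $i+1$ wherever they appear. A reduced composition for $\pi$ is a sequence $s_{i_t}\cdots s_{i_1}$ with $t\ge 0$ minimal such that $s_{i_t}.(\cdots(s_{i_1}.(1,2,\dots,n))\cdots)=\pi$. On polynomials in $x_1,\dots,x_n$, $s_i$ interchanges $x_i$ and $x_{i+1}$, $\rho_i.P:=\dfrac{x_iP-s_i.(x_iP)}{x_i-x_{i+1}}$ and $\bar\rho_i.P:=\rho_i.P-P$. For a reduced composition $s_{i_t}\cdots s_{i_1}$ for $\pi$, $c_\lambda(\pi;x):=\bar\rho_{i_t}\cdots\bar\rho_{i_1}.x_1^{\lambda_1}x_2^{\lambda_2}\cdots x_n^{\lambda_n}$ (independent of the choice of reduced composition). Scanning. The earliest weakly increasing subsequence (EWIS) of a sequence $(x_1,x_2,\dots)$ is $(x_{i_1},x_{i_2},\dots)$ with $i_1=1$ and, for $j>1$, $i_j$ minimal with $i_j>i_{j-1}$ and $x_{i_{j-1}}\le x_{i_j}$. For $T\in\mathcal{T}_\lambda$ and $1\le l\le\lambda_1$, let $T^{(l,\zeta_l)}$ be $T$ with its first $l-1$ columns removed (column indexing retained).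 For $k=\zeta_l,\zeta_l-1,\dots,1$: read the bottom values of the nonempty columns of $T^{(l,k)}$ from left to right (starting with column $l$, whose bottom is at $(l,k)$), take the EWIS of this sequence, and let the scanning path $P(T;l,k)$ be the sequence of locations of this EWIS; then let $T^{(l,k-1)}$ be the (semistandard) tableau obtained from $T^{(l,k)}$ by removing the boxes of $P(T;l,k)$. Let $U^{(l,k)}$ be $T^{(l,k)}$ with its leftmost remaining column (column $l$) removed. The sets $C$. Let $(l,k)\in\lambda$. If $l=\lambda_1$, then $C_\lambda(T,\pi;l,k):=\{Y(l,k)\}$. If $1\le l<\lambda_1$, write $U=U^{(l,k)}$. If $m(U)>Y(l,k)$, then $C_\lambda(T,\pi;l,k):=\emptyset$. If $m(U)=Y(l,k)$, then $C_\lambda(T,\pi;l,k):=[k,\min\{Y(l,k),T(l,k+1)-1,T(l+1,k)\}]$. If $m(U)<Y(l,k)$, then $C_\lambda(T,\pi;l,k):=\{Y(l,k)\}\cap[k,\min\{T(l,k+1)-1,T(l+1,k)\}]$. *)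

(* Defs.v *)
From HB Require Import structures.
From mathcomp Require Import all_boot all_order all_algebra all_fingroup.
From mathcomp Require Import mpoly.

Set Implicit Arguments.
Unset Strict Implicit.
Unset Printing Implicit Defensive.

Import GRing.Theory.

(* Rows, columns, tableau values and positions in one-line notation are
   1-based natural numbers [j], [i], [l], [k], with the column index first.
   The elements of ['I_n] are 0-based: [i : 'I_n] stands for the value [i.+1]
   of [1,n] and for the variable x_{i+1}; [i : 'I_n.-1] stands for the index
   [i.+1] of s_1, ..., s_{n-1}. *)

(** * Partitions and shapes *)

Definition is_partition n (lam : n.-tuple nat) : bool := sorted geq lam.

Definition row_len n (lam : n.-tuple nat) (i : nat) : nat := nth 0 lam i.-1.

Definition col_len n (lam : n.-tuple nat) (j : nat) : nat :=
  count (fun p => j <= p) lam.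

Definition in_shape n (lam : n.-tuple nat) (j i : nat) : bool :=
  [&& 0 < j, 0 < i & j <= row_len lam i].

Definition box n (lam : n.-tuple nat) : Type :=
  {p : 'I_(row_len lam 1).+1 * 'I_n.+1 | in_shape lam p.1 p.2}.

HB.instance Definition _ n (lam : n.-tuple nat) := Finite.on (box lam).

Definition bcol n (lam : n.-tuple nat) (b : box lam) : nat := (val b).1.
Definition brow n (lam : n.-tuple nat) (b : box lam) : nat := (val b).2.

(** * Tableaux *)

Definition filling n (lam : n.-tuple nat) : Type := {ffun box lam -> 'I_n}.

HB.instance Definition _ n (lam : n.-tuple nat) := Finite.on (filling lam).

(* T(j,i), with the junk value 0 outside the shape; the boundary conventions
   are in [right_val] and [below_val]. *)
Definition entry n (lam : n.-tuple nat) (T : filling lam) (j i : nat) : nat :=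
  if [pick b : box lam | (bcol b == j) && (brow b == i)] is Some b
  then (T b).+1 else 0.

Definition semistandard n (lam : n.-tuple nat) (T : filling lam) : bool :=
  [forall b : box lam, forall b' : box lam,
     ((bcol b' == (bcol b).+1) && (brow b' == brow b) ==> (T b <= T b'))
  && ((bcol b' == bcol b) && (brow b' == (brow b).+1) ==> (T b < T b'))].

Definition right_val n (lam : n.-tuple nat) (T : filling lam) (l k : nat) :=
  if l == row_len lam k then n else entry T l.+1 k.

Definition below_val n (lam : n.-tuple nat) (T : filling lam) (l k : nat) :=
  if k == col_len lam l then n.+1 else entry T l k.+1.

Definition weight n (lam : n.-tuple nat) (T : filling lam) : {mpoly int[n]} :=
  (\prod_(i < n) 'X_i ^+ #|[set b : box lam | T b == i]|)%R.

(** * Permutations and keys *)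

Definition one_line n (pi : 'S_n) : seq nat := [seq (pi i).+1 | i <- enum 'I_n].

Definition perm_at n (pi : 'S_n) (i : nat) : nat := nth 0 (one_line pi) i.-1.

(* The sequence q_0, q_1, ..., q_r, q_{r+1}. *)
Definition col_bounds n (lam : n.-tuple nat) : seq nat :=
  0 :: rcons (sort leq (undup [seq col_len lam j | j <- iota 1 (row_len lam 1)]))
             n.

Definition in_Slam n (lam : n.-tuple nat) (pi : 'S_n) : Prop :=
  let q := nth 0 (col_bounds lam) in
  forall s i j : nat, 1 <= s < size (col_bounds lam) ->
    q s.-1 + 1 <= i -> i < j -> j <= q s -> perm_at pi i < perm_at pi j.

(* Y_lam(pi)(j,i) *)
Definition key n (lam : n.-tuple nat) (pi : 'S_n) (j i : nat) : nat :=
  nth 0 (sort leq (take (col_len lam j) (one_line pi))) i.-1.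

(** * Atoms *)

Definition idx n (i : 'I_n.-1) : 'I_n := widen_ord (leq_pred n) i.
Definition idxS n (i : 'I_n.-1) : 'I_n :=
  Ordinal (etrans (esym (ltn_predRL i n)) (ltn_ord i)).

Definition adj n (i : 'I_n.-1) : 'S_n := tperm (idx i) (idxS i).

(* s_i acts on the values of the tuple; in MathComp [(s * t) x = t (s x)]. *)
Definition sact n (i : 'I_n.-1) (pi : 'S_n) : 'S_n := (pi * adj i)%g.

(* The word s_{i_t} ... s_{i_1} is the sequence [:: i_t; ...; i_1], whose last
   letter acts first. *)
Definition composition n (w : seq 'I_n.-1) : 'S_n :=
  foldr (@sact n) 1%g w.

Definition reduced_composition n (pi : 'S_n) (w : seq 'I_n.-1) : Prop :=
  composition w = pi /\
  forall w' : seq 'I_n.-1, composition w' = pi -> size w <= size w'.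

Section Demazure.
Local Open Scope ring_scope.

Lemma sub_msym_dvd n (i : 'I_n.-1) (P : {mpoly int[n]}) :
  exists Q, Q * ('X_(idx i) - 'X_(idxS i)) = P - msym (adj i) P.
Proof.
pose D (R : {mpoly int[n]}) :=
  exists Q, Q * ('X_(idx i) - 'X_(idxS i)) = R - msym (adj i) R.
have DD R S : D R -> D S -> D (R + S).
  move=> [Q eQ] [Q' eQ']; exists (Q + Q').
  by rewrite mulrDl eQ eQ' msymD opprD addrACA.
have DM R S : D R -> D S -> D (R * S).
  move=> [Q eQ] [Q' eQ']; exists (Q * S + msym (adj i) R * Q').
  by rewrite mulrDl mulrAC eQ -mulrA eQ' msymM mulrBl mulrBr addrA subrK.
have D1 : D 1 by exists 0; rewrite mul0r msym1 subrr.
have DX j : D 'X_j.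
  rewrite /D /msym mmapX mmap1U /adj permE /=.
  case: eqP => [->|_]; first by exists 1; rewrite mul1r.
  case: eqP => [->|_]; first by exists (-1); rewrite mulN1r opprB.
  by exists 0; rewrite mul0r subrr.
elim/mpolyind: P => [|c m p _ _ IHp]; first by exists 0; rewrite mul0r msym0 subrr.
apply: DD => //; have [Q eQ] : D 'X_[m].
  rewrite mpolyXE_id; apply: (big_ind D) => // j _.
  by elim: (m j) => [|k IHk]; rewrite ?expr0 // exprS; apply: DM.
by exists (c *: Q); rewrite msymZ -scalerBr -eQ scalerAl.
Qed.

Lemma rho_exists n (i : 'I_n.-1) (P : {mpoly int[n]}) :
  exists Q, Q * ('X_(idx i) - 'X_(idxS i))
            == 'X_(idx i) * P - msym (adj i) ('X_(idx i) * P).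
Proof. by have [Q eQ] := sub_msym_dvd i ('X_(idx i) * P); exists Q; apply/eqP. Qed.

(* The exact quotient of x_i P - s_i.(x_i P) by x_i - x_{i+1}, which is unique
   because {mpoly int[n]} is an integral domain. *)
Definition rho n (i : 'I_n.-1) (P : {mpoly int[n]}) : {mpoly int[n]} :=
  xchoose (rho_exists i P).

Lemma rhoP n (i : 'I_n.-1) (P : {mpoly int[n]}) :
  rho i P * ('X_(idx i) - 'X_(idxS i))
  = 'X_(idx i) * P - msym (adj i) ('X_(idx i) * P).
Proof. exact/eqP/(xchooseP (rho_exists i P)). Qed.

Definition rhobar n (i : 'I_n.-1) (P : {mpoly int[n]}) : {mpoly int[n]} :=
  rho i P - P.

(* c_lam(pi;x), computed along a reduced composition [w] for [pi]. *)
Definition atom n (lam : n.-tuple nat) (w : seq 'I_n.-1) : {mpoly int[n]} :=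
  foldr (@rhobar n) (\prod_(i < n) 'X_i ^+ tnth lam i) w.

End Demazure.

(** * Scanning *)

Fixpoint ewis_from (A : Type) (v : A -> nat) (a : A) (s : seq A) : seq A :=
  if s is b :: s' then
    if v a <= v b then b :: ewis_from v b s' else ewis_from v a s'
  else [::].

(* Earliest weakly increasing subsequence of the values [v x], returned as the
   sequence of the items [x] (here locations) carrying them. *)
Definition ewis (A : Type) (v : A -> nat) (s : seq A) : seq A :=
  if s is a :: s' then a :: ewis_from v a s' else [::].

(* A tableau obtained from [T] by removing boxes at the bottoms of columns is
   given by the lengths [h j] of its columns. *)
Definition bottoms n (lam : n.-tuple nat) (h : nat -> nat) : seq (nat * nat) :=
  [seq (j, h j) | j <- iota 1 (row_len lam 1) & 0 < h j].

Definition entry_at n (lam : n.-tuple nat) (T : filling lam) (p : nat * nat) :=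
  entry T p.1 p.2.

Definition path_of n (lam : n.-tuple nat) (T : filling lam) (h : nat -> nat) :
    seq (nat * nat) :=
  ewis (entry_at T) (bottoms lam h).

Definition remove_path n (lam : n.-tuple nat) (T : filling lam)
    (h : nat -> nat) : nat -> nat :=
  fun j => if (j, h j) \in path_of T h then (h j).-1 else h j.

(* T^{(l,k)}, for 1 <= k <= zeta_l: column [l] then has length [k]. *)
Definition scanT n (lam : n.-tuple nat) (T : filling lam) (l k : nat) :
    nat -> nat :=
  iter (col_len lam l - k) (remove_path T)
       (fun j => if l <= j then col_len lam j else 0).

(* U^{(l,k)} *)
Definition scanU n (lam : n.-tuple nat) (T : filling lam) (l k : nat) :
    nat -> nat :=
  fun j => if j == l then 0 else scanT T l k j.

(* The value is 1 when there is no column left; otherwise all the bottom values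
   are at least 1. *)
Definition max_bottom n (lam : n.-tuple nat) (T : filling lam)
    (h : nat -> nat) : nat :=
  \big[maxn/1]_(p <- bottoms lam h) entry_at T p.

(** * The sets C_lam(T,pi;l,k) *)

Definition Cset n (lam : n.-tuple nat) (T : filling lam) (pi : 'S_n)
    (l k : nat) : pred nat :=
  let y := key lam pi l k in
  let m := max_bottom T (scanU T l k) in
  let b := minn (below_val T l k - 1) (right_val T l k) in
  if l == row_len lam 1 then pred1 y
  else if y < m then pred0
  else if m == y then [pred v | k <= v <= minn y b]
  else [pred v | (v == y) && (k <= v <= b)].

(* Main.v *)
(* The scanning values S(l,k), the last values of the paths P(T;l,k), form the
   right key of T: the earliest weakly increasing subsequence of a word ends at
   its maximum, and the condition T(l,k) \in C(l,k) says exactly that S(l,k) =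
   Y(l,k).  Scanning all the paths of column l amounts to sliding this column to
   the right past the columns l+1, l+2, ... one at a time.

   The atom is then computed by induction on a reduced word.  Cut the
   semistandard tableaux into i-strings for the crystal operators.  A local
   analysis of one slide shows that along a string the key is constant, except
   that it may go from Y to s_i.Y between the highest element and the next one;
   and that in the key of a highest element no column contains i+1 but not i.
   If i precedes i+1 in pi, let P and Q be the sums of the weights over the
   tableaux of key Y(pi) and s_i.Y(pi).  The tableaux counted by P + Q form whole
   strings, those counted by Q whole strings deprived of their highest elements.
   Reversing these (shortened) strings shows that P + Q and x_i Q are symmetric in
   x_i and x_{i+1}, and this says that the operator of the atom maps P to Q. *)

Require Import Defs.
From mathcomp Require Import all_boot all_order all_algebra all_fingroup.
From mathcomp Require Import mpoly.
From mathcomp Require Import zify.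

Set Implicit Arguments.
Unset Strict Implicit.
Unset Printing Implicit Defensive.

Import Order.TTheory GRing.Theory Num.Theory.

(** * Sliding a column past another one *)

(* Columns are read from bottom to top, as decreasing lists.  Jeu de taquin moves
   the column [C] past a column [D] on its right, and [absorb C D] is the
   resulting right column: each entry of [D], from the largest on, replaces the
   largest entry of [C] still available that it weakly exceeds. *)
Fixpoint absorb (C D : seq nat) : seq nat :=
  match C, D with
  | c :: C', d :: D' =>
      if c <= d then d :: absorb C' D' else c :: absorb C' D
  | _, _ => C
  end.

Notation decr := (sorted gtn).

Definition plus (v : nat) (s : seq nat) := (v \in s) && (v.+1 \notin s).
Definition minus (v : nat) (s : seq nat) := (v.+1 \in s) && (v \notin s).

Definition swap v x := if x == v then v.+1 else if x == v.+1 then v else x.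

(** The guard keeps decreasing lists decreasing: when both values are present, [map (swap v)] would
    merely disorder them. *)
Definition toggle (v : nat) (s : seq nat) :=
  if (v \in s) (+) (v.+1 \in s) then map (swap v) s else s.

Lemma decr_cons c C : decr (c :: C) = all (gtn c) C && decr C.
Proof. by rewrite /= path_sortedE //; apply: rev_trans ltn_trans. Qed.

Lemma decr_uniq s : decr s -> uniq s.
Proof.
by apply: sorted_uniq; [apply: rev_trans ltn_trans | move=> x; apply: ltnn].
Qed.

Lemma absorb_nil C : absorb C [::] = C.
Proof. by case: C. Qed.

Lemma size_absorb C D : size (absorb C D) = size C.
Proof. by elim: C D => [|c C IH] [|d D] //=; case: ifP => _ /=; rewrite IH. Qed.

Lemma mem_absorb C D x : x \in absorb C D -> (x \in C) || (x \in D).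
Proof.
elim: C D => [|c C IH] [|d D] //=; first by rewrite orbF.
by case: ifP => _; rewrite inE => /predU1P[->|/IH]; rewrite !inE ?eqxx ?orbT //;
   case/orP => ->; rewrite ?orbT.
Qed.

Lemma gtn_absorb y C D :
  all (gtn y) C -> all (gtn y) D -> all (gtn y) (absorb C D).
Proof.
move=> /allP hC /allP hD; apply/allP => x /mem_absorb /orP[/hC|/hD] //.
Qed.

Lemma absorb_decr C D : decr C -> decr D -> decr (absorb C D).
Proof.
elim: C D => [|c C IH] [|d D] //; rewrite !decr_cons =>
  /andP[hc hC] /andP[hd hD].
rewrite [absorb _ _]/=; case: leqP => hcd; rewrite decr_cons.
  rewrite IH // andbT gtn_absorb //; apply: sub_all hc => x /=; lia.
rewrite IH ?decr_cons ?hd // andbT gtn_absorb //= hcd /=.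
by apply: sub_all hd => x /=; lia.
Qed.

Lemma leq_absorb C D k : nth 0 C k <= nth 0 (absorb C D) k.
Proof.
elim: C D k => [|c C IH] [|d D] [|k] //=; case: ifP => h //=; exact: IH.
Qed.

(** Entries of [C] that exceed the current entry of [D] are kept, so each entry of [D] ends up
    replacing its own copy in [C]. *)
Lemma absorb_sub C D : decr C -> decr D -> {subset D <= C} -> absorb C D = C.
Proof.
elim: C D => [|c C IH] [|d D] //; rewrite !decr_cons => /andP[/allP hc hC].
move=> /andP[/allP hd hD] sub /=.
have [e|ne] := eqVneq d c.
  rewrite e leqnn IH // => x xD.
  by move: (sub x) (hd x xD); rewrite !inE xD orbT e =>
    /(_ isT) /predU1P[->|//] /=; lia.
have dC: d \in C by move: (sub d); rewrite !inE eqxx (negPf ne) => /(_ isT).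
have := hc _ dC; rewrite /= => lt; rewrite leqNgt lt /= IH ?decr_cons ?hD
  ?andbT //.
  by apply/allP.
move=> x; rewrite inE => /predU1P[->//|xD].
move: (sub x) (hd x xD); rewrite !inE xD orbT => /(_ isT) /predU1P[->|//] /=;
  lia.
Qed.

(** Equal heads react alike. Otherwise the head [c] of [Y] exceeds all of [X]: if [c] takes [d], so
    does the head of [X]; if not, [c] is kept and all of [X] is compared with the rest of [Y]. *)
Lemma absorb_mono X Y D : decr X -> decr Y ->
  {subset X <= Y} -> {subset absorb X D <= absorb Y D}.
Proof.
elim: Y X D => [|c Y IH] [|b X] D //; first by move=> _ _ /(_ b);
  rewrite !inE eqxx => /(_ isT).
rewrite !decr_cons => /andP[/allP hb hX] /andP[/allP hc hY] sub.
have sub' : {subset X <= Y}.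
  move=> x xX; move: (sub x); rewrite !inE xX orbT => /(_ isT) /predU1P[e|//].
  have := hb _ xX; rewrite /= e => lt.
  move: (sub b); rewrite !inE eqxx => /(_ isT) /predU1P[e'|/hc /=]; lia.
case: D => [|d D] //=.
have [e|ne] := eqVneq b c.
  rewrite e; case: leqP => h x; rewrite !inE => /predU1P[->|/IH ->//];
    rewrite ?eqxx ?orbT //.
have bY : b \in Y by move: (sub b); rewrite !inE eqxx (negPf ne) => /(_ isT).
have := hc _ bY; rewrite /= => lt.
have [h|h] := leqP c d.
  rewrite (leq_trans (ltnW lt) h) => x; rewrite !inE => /predU1P[->|/IH ->//];
    rewrite ?eqxx ?orbT //.
move=> x xin; rewrite inE; apply/orP; right; apply: (IH (b :: X)) => //.
  by rewrite decr_cons hX andbT; apply/allP.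
by move=> y; rewrite inE => /predU1P[->|/sub'].
Qed.

(* For decreasing lists, [D] may stand immediately to the right of [C] in a
   semistandard tableau. *)
Definition dominated (C D : seq nat) :=
  forall x, count (leq^~ x) D <= count (leq^~ x) C.

Lemma count_leq_all d D : all (gtn d) D -> count (leq^~ d) D = size D.
Proof. by move=> h; apply/eqP; rewrite -all_count; apply: sub_all h => x /=;
  lia. Qed.

(** Domination provides every entry of [D] with a partner in [C], and the greedy choice of the
    largest available partner preserves domination for the remaining entries. *)
Lemma sub_absorb C D : decr C -> decr D -> dominated C D ->
  {subset D <= absorb C D}.
Proof.
elim: C D => [|c C IH] [|d D] //.
  by move=> _ _ /(_ d) /=; rewrite leqnn.
rewrite !decr_cons => /andP[hc hC] /andP[hd hD] dom /=.
have hsD := count_leq_all hd; have hsC := count_leq_all hc.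
have leD x : count (leq^~ x) D <= size D by apply: count_size.
have leC x : count (leq^~ x) C <= size C by apply: count_size.
have monoC x : c <= x -> count (leq^~ x) C = size C.
  by move=> h; apply/eqP; rewrite eqn_leq leC -hsC sub_count // => y /=; lia.
have monoD x : d <= x -> count (leq^~ x) D = size D.
  by move=> h; apply/eqP; rewrite eqn_leq leD -hsD sub_count // => y /=; lia.
have lt0 x : x < c -> c <= x = false by lia.
case: leqP => h.
  suff dom' : dominated C D.
    by move=> x; rewrite !inE => /predU1P[->|/(IH _ hC hD dom') ->];
      rewrite ?eqxx ?orbT.
  move=> x; move: (dom x) (dom (maxn c d)) (leD x) (leC x) (monoC x) (monoC
    (maxn c d)) (monoD (maxn c d)) => /=.
  rewrite leq_maxl leq_maxr; case: leqP; case: leqP; lia.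
suff dom' : dominated C (d :: D).
  have hdD : decr (d :: D) by rewrite decr_cons hd.
  by move=> x /(IH _ hC hdD dom'); rewrite inE => ->; rewrite orbT.
move=> x; move: (dom x) (dom d) (leD x) (leC x) (leC d) (monoC x) (monoC c) =>
  /=.
by rewrite leqnn; case: leqP; case: leqP; lia.
Qed.

(** * Slides under the exchange of v and v+1 *)

Lemma swapK v : involutive (swap v).
Proof. by move=> x; rewrite /swap; do !case: eqP => //=; lia. Qed.

Lemma swap_id v x : x != v -> x != v.+1 -> swap v x = x.
Proof. by rewrite /swap => /negPf-> /negPf->. Qed.

Lemma swap_lt v s : all (gtn v) s -> map (swap v) s = s.
Proof.
move=> /allP h; apply: map_id_in => x /h /= lt; apply: swap_id; lia.
Qed.

Lemma lt_notin v s : all (gtn v) s -> ((v \in s) = false) * ((v.+1 \in s) =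
  false).
Proof.
by move=> /allP h; split; apply/negP => /h /=; lia.
Qed.

Lemma swap_gt v x : v.+1 < x -> swap v x = x.
Proof. by move=> h; rewrite swap_id // gtn_eqF // ltnW. Qed.

Lemma plus_cons v x s : v.+1 < x -> plus v (x :: s) = plus v s.
Proof.
by move=> h; rewrite /plus !inE (ltn_eqF h) (ltn_eqF (ltnW h)).
Qed.

Lemma minus_behead v c C : decr (c :: C) -> ~~ minus v (c :: C) -> ~~ minus v C.
Proof.
rewrite decr_cons => /andP[/allP hc _]; apply: contra => /andP[vC nvC].
rewrite /minus !inE vC orbT (negPf nvC) orbF /=; apply/eqP => e.
by have := hc _ vC; rewrite -e /= ltnNge leqnSn.
Qed.

Lemma minus_head v C : decr (v.+1 :: C) -> ~~ minus v (v.+1 :: C) ->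
  exists C', C = v :: C'.
Proof.
rewrite /minus mem_head decr_cons negbK inE (ltn_eqF (ltnSn v)) /=.
case: C => [|b C] //= /andP[/andP[lt _] pC] /predU1P[->|vC]; first by exists C.
have := pC; rewrite path_sortedE; last exact: rev_trans ltn_trans.
by move=> /andP[/allP/(_ _ vC) /=]; lia.
Qed.

(** Entries of [Z] above v+1 act alike on both sides, so only the fate of v matters. An entry of [D]
    above v replaces it, raised or not. Otherwise, as [D] is not plus, v does not meet another v,
    and it survives, raised or not. *)
Lemma absorb_swap_l v Z D : decr Z -> decr D -> plus v Z -> ~~ plus v D ->
  absorb (map (swap v) Z) D = absorb Z D \/
  [/\ v.+1 \notin D, plus v (absorb Z D) &
      absorb (map (swap v) Z) D = map (swap v) (absorb Z D)].
Proof.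
elim: Z D => [|c Z IH] D //.
rewrite decr_cons => /andP[hc hZ] hD pZ npD.
have [ec|nec] := eqVneq c v.
  subst c.
  have sZ : map (swap v) Z = Z by apply: swap_lt.
  have -> : map (swap v) (v :: Z) = v.+1 :: Z by rewrite /= sZ /swap eqxx.
  case: D hD npD => [|d D]; rewrite ?decr_cons => hD npD.
    by right; split => //=; rewrite sZ /swap eqxx.
  move/andP: hD => [hd hD] /=.
  have [h|h] := leqP v.+1 d; first by left; rewrite (ltnW h).
  have nd : d != v.
    apply: contra npD => /eqP e; subst d.
    by rewrite /plus !inE eqxx /= (lt_notin hd) orbF; lia.
  have lt : d < v by lia.
  rewrite leqNgt lt /=; right.
  have av : all (gtn v) (d :: D) by rewrite /= lt; apply: sub_all hd => x /=;
    lia.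
  have aa := gtn_absorb hc av.
  by rewrite (lt_notin av) /plus !inE eqxx /= swap_lt // (lt_notin aa) orbF
    /swap eqxx; split=> //; lia.
have vZ : v \in Z by move: pZ; rewrite /plus !inE [v == c]eq_sym (negPf nec) =>
  /andP[].
have pZ' : plus v Z by move: pZ; rewrite /plus !inE vZ orbT negb_or =>
  /andP[_ /andP[]].
have ltc : v.+1 < c.
  have /allP/(_ _ vZ) /= := hc; move: pZ; rewrite /plus !inE; lia.
have -> : map (swap v) (c :: Z) = c :: map (swap v) Z by rewrite /= swap_gt.
case: D hD npD => [|d D]; rewrite ?decr_cons => hD npD.
  right; rewrite !absorb_nil; split=> //; rewrite /= swap_id //; lia.
move/andP: hD => [hd hD] /=.
have [h|h] := leqP c d.
  have npD' : ~~ plus v D by move: npD; rewrite /plus !inE;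
    case: (v \in D) => //=; case: (v.+1 \in D); rewrite ?orbF ?orbT //=; lia.
  have [->|[h1 h2 h3]] := IH D hZ hD pZ' npD'; first by left.
  have ltd := leq_trans ltc h; right.
  by rewrite h3 /= swap_gt // plus_cons // inE (negPf h1) (ltn_eqF ltd).
have hdD : decr (d :: D) by rewrite decr_cons hd.
have [->|[h1 h2 h3]] := IH (d :: D) hZ hdD pZ' npD; first by left.
by right; rewrite h3 /= swap_gt // plus_cons.
Qed.

(** The entries v and v+1 of the two versions of [C] replace the same entry of [X], unless v+1 is
    still available there. As [X] is not minus, v then stands next to it, and both versions end with
    the pair v+1, v. *)
Lemma absorb_swap_r v X C : decr X -> decr C -> ~~ minus v X -> plus v C ->
  absorb X (map (swap v) C) = absorb X C \/
  (plus v (absorb X C) /\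
      absorb X (map (swap v) C) = map (swap v) (absorb X C)).
Proof.
elim: X C => [|c X IH] C; first by left.
case: C => [|d C] // hcX hdC nmX pC.
have := hcX; have := hdC; rewrite !decr_cons => /andP[hd hC] /andP[hc hX].
have [e|ne] := eqVneq d v.
  subst d.
  have eC : map (swap v) (v :: C) = v.+1 :: C by rewrite /= swap_lt // /swap
    eqxx.
  rewrite eC.
  rewrite /=; case: (ltngtP c v.+1) => h.
  - rewrite -ltnS h; right.
    have av : all (gtn v) (absorb X C) by apply: gtn_absorb => //;
      apply: sub_all hc => x /=; lia.
    by rewrite /plus !inE eqxx /= (lt_notin av) swap_lt // orbF /swap eqxx;
      split => //; lia.
  - have -> : (c <= v) = false by lia.
    have nmX' := minus_behead hcX nmX.
    have [e|[h1 h2]] := IH (v :: C) hX hdC nmX' pC.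
      by left; rewrite -e eC.
    by right; rewrite -eC h2 /= swap_gt // plus_cons.
  - have -> : (c <= v) = false by lia.
    (* Raised, the entry takes v+1 and leaves v; unraised, it leaves v+1 and takes v. The outcome is
       the same. *)
    left; subst c; have [Y eX] := minus_head hcX nmX.
    rewrite eX /= leqnn; congr (_ :: _).
    case: C hd {hC pC eC hdC} => [|d C]; first by rewrite absorb_nil.
    by move=> /andP[/= lt _]; rewrite leqNgt lt.
have vC : v \in C by move: pC; rewrite /plus !inE [v == d]eq_sym (negPf ne) =>
  /andP[].
have pC' : plus v C by move: pC; rewrite /plus !inE vC orbT negb_or =>
  /andP[_ /andP[]].
have ltd : v.+1 < d.
  have /allP/(_ _ vC) /= := hd; move: pC; rewrite /plus !inE; lia.
have eC : map (swap v) (d :: C) = d :: map (swap v) C by rewrite /= swap_gt.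
have nmX' := minus_behead hcX nmX.
rewrite eC /=; have [h|h] := leqP c d.
  have [->|[h2 h3]] := IH C hX hC nmX' pC'; first by left.
  by right; rewrite h3 /= swap_gt // plus_cons.
have [e|[h2 h3]] := IH (d :: C) hX hdC nmX' pC.
  by left; rewrite -e eC.
have ltc := ltn_trans ltd h.
by right; rewrite -eC h3 /= swap_gt // plus_cons.
Qed.

(** If v is in [D], it is in the result by [sub_absorb]. Otherwise [D] contains neither v nor v+1,
    so an entry of [D] too small to replace v+1 cannot replace the v next to it either: if v+1
    survives, so does v. *)
Lemma absorb_minus v X D : decr X -> decr D -> dominated X D ->
  ~~ minus v D -> (v \in D) || ~~ minus v X -> ~~ minus v (absorb X D).
Proof.
move=> hX hD dom nmD.
have [vD _|vD /= nmX] := boolP (v \in D).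
  by rewrite /minus negb_and negbK (sub_absorb hX hD dom vD) orbT.
have vD' : v.+1 \notin D by move: nmD; rewrite /minus vD andbT.
elim: X D hX hD nmX vD vD' {dom nmD} => [|c X IH] [|d D] //.
move=> hcX hdD nmX; have nmX' := minus_behead hcX nmX.
have := hcX; have := hdD; rewrite !decr_cons => /andP[hd hD] /andP[hc hX].
rewrite !inE !negb_or => /andP[nd vD] /andP[nd' vD'] /=.
have [h|h] := leqP c d.
  by have := IH D hX hD nmX' vD vD'; rewrite /minus !inE (negPf nd) (negPf nd').
have [e|ne] := eqVneq c v.+1.
  subst c; have [Y eX] := minus_head hcX nmX.
  by rewrite /minus !inE eqxx eX /= leqNgt (_ : d < v) /= ?inE ?eqxx ?orbT //;
    lia.
have := IH (d :: D) hX hdD nmX'.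
rewrite !inE (negPf nd) (negPf nd') => /(_ vD vD').
by rewrite /minus !inE eq_sym (negPf ne) /=; case: (v.+1 \in _) => //=;
  rewrite !negbK => ->; rewrite orbT.
Qed.

(** * Boxes, entries and columns of tableaux *)

Lemma leq_count_in (T : eqType) (a b : pred T) s :
  {in s, subpred a b} -> count a s <= count b s.
Proof.
move=> h; rewrite -(@eq_in_count _ (predI a b) a) ?sub_count // => x;
  first by case/andP.
by move=> xs /=; apply/idP/idP => [/andP[]//|ax]; rewrite ax h.
Qed.

Lemma geq_sorted_count (s : seq nat) j i : sorted geq s -> 0 < j ->
  (j <= nth 0 s i) = (i < count (leq j) s).
Proof.
elim: s i => [|a s IH] i; first by rewrite nth_nil /=; lia.
rewrite /= path_sortedE; last exact: rev_trans leq_trans.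
move=> /andP[ha hs] j0.
have [ja|aj] := leqP j a.
  by case: i => [|i] /=; rewrite ?ja // IH //; lia.
have -> : count (leq j) s = 0.
  apply/eqP; rewrite -leqn0 leqNgt -has_count; apply/negP => /hasP[x xs jx].
  by have /= := allP ha _ xs; lia.
case: i => [|i] /=; first by lia.
have [lt|le] := ltnP i (size s); last by rewrite nth_default //; lia.
by have /= := allP ha _ (mem_nth 0 lt); lia.
Qed.

Section Tableaux.
Variables (n : nat) (lam : n.-tuple nat).
Hypothesis hlam : is_partition lam.
Local Notation r := (row_len lam 1).
Local Notation clen := (col_len lam).
Implicit Types (T : filling lam) (b : box lam).

Lemma leq_row_len j i : 0 < j -> 0 < i -> (j <= row_len lam i) = (i <= clen j).
Proof. by case: i => // i j0 _; rewrite /row_len geq_sorted_count. Qed.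

Lemma in_shapeE j i : in_shape lam j i = (0 < j) && (0 < i <= clen j).
Proof.
rewrite /in_shape; case: (posnP j) => //= j0; case: (posnP i) => //= i0.
by rewrite leq_row_len.
Qed.

Lemma col_len_le j : clen j <= n.
Proof. by rewrite -[X in _ <= X](size_tuple lam) count_size. Qed.

Lemma col_len_mono j k : j <= k -> clen k <= clen j.
Proof. by move=> jk; apply: sub_count => x /=; apply: leq_trans. Qed.

Lemma col_len_gt0 j : 0 < j -> (0 < clen j) = (j <= r).
Proof. by move=> j0; rewrite leq_row_len. Qed.

Lemma bcol_brow b : (0 < bcol b) && (0 < brow b <= clen (bcol b)).
Proof. by rewrite -in_shapeE; apply: (valP b). Qed.

Lemma bcol_le b : 0 < bcol b <= r.
Proof. by have /and3P[h0 h1 h2] := bcol_brow b; rewrite h0 -col_len_gt0 //;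
  lia. Qed.

Lemma box_inj b b' : bcol b = bcol b' -> brow b = brow b' -> b = b'.
Proof.
move=> e1 e2; apply: val_inj; rewrite [val b]surjective_pairing [val
  b']surjective_pairing.
by congr (_, _); apply: val_inj.
Qed.

Lemma box_exists j i : 0 < j -> 0 < i <= clen j ->
  exists b : box lam, bcol b = j /\ brow b = i.
Proof.
move=> j0 hi.
have hj : j < r.+1 by rewrite ltnS -col_len_gt0 //; lia.
have hi' : i < n.+1 by have := col_len_le j; lia.
have h : in_shape lam (Ordinal hj, Ordinal hi').1 (Ordinal hj, Ordinal hi').2.
  by rewrite in_shapeE /= j0.
by exists (exist _ (Ordinal hj, Ordinal hi') h).
Qed.

Lemma entry_box T b : entry T (bcol b) (brow b) = (T b).+1.
Proof.
rewrite /entry; case: pickP => [b' /andP[/eqP h1 /eqP h2]|/(_ b)];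
  last by rewrite !eqxx.
by rewrite (box_inj h1 h2).
Qed.

Lemma entry_gt0 T j i : (0 < entry T j i) = (0 < j) && (0 < i <= clen j).
Proof.
apply/idP/idP => [|/andP[j0 /(box_exists j0)[b [<- <-]]]];
  last by rewrite entry_box.
rewrite /entry; case: pickP => // b /andP[/eqP <- /eqP <-] _; exact: bcol_brow.
Qed.

Lemma entry_le T j i : entry T j i <= n.
Proof. by rewrite /entry; case: pickP => // b _. Qed.

Lemma semistandardP T :
  reflect ((forall j i, 0 < j -> 0 < i <= clen j.+1 ->
              entry T j i <= entry T j.+1 i) /\
           (forall j i, 0 < j -> 0 < i < clen j ->
              entry T j i < entry T j i.+1))
          (semistandard T).
Proof.
apply: (iffP forallP) => [h|[h1 h2] b].
  split=> j i j0 hi.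
    have [||b [e1 e2]] := @box_exists j i; rewrite ?j0 //.
      by have := col_len_mono (leqnSn j); lia.
    have [||b' [e1' e2']] := @box_exists j.+1 i; rewrite ?j0 //.
    have /forallP/(_ b') := h b; rewrite e1 e2 e1' e2' !eqxx /= => /andP[le _].
    by rewrite -{1}e1 -{1}e2 -{1}e1' -e2' !entry_box.
  have [||b [e1 e2]] := @box_exists j i; rewrite ?j0 //; first by lia.
  have [||b' [e1' e2']] := @box_exists j i.+1; rewrite ?j0 //; first by lia.
  have /forallP/(_ b') := h b; rewrite e1 e2 e1' e2' !eqxx /= => /andP[_ lt].
  by rewrite -{1}e1 -{1}e2 -{1}e1' -e2' !entry_box.
apply/forallP => b'; have /and3P[j0 i0 il] := bcol_brow b.
have /and3P[j0' i0' il'] := bcol_brow b'.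
apply/andP; split; apply/implyP => /andP[/eqP e1 /eqP e2].
  have := h1 (bcol b) (brow b) j0.
  rewrite e1 e2 in il'; rewrite i0 il' => /(_ isT).
by rewrite -e1 -{2}e2 !entry_box.
have := h2 (bcol b) (brow b) j0.
rewrite e1 e2 in il'; rewrite i0 il' => /(_ isT).
by rewrite -e2 -{2}e1 !entry_box.
Qed.

Definition tcol T j : seq nat := [seq entry T j k | k <- rev (iota 1 (clen j))].

Lemma size_col T j : size (tcol T j) = clen j.
Proof. by rewrite size_map size_rev size_iota. Qed.

Lemma mem_colP T j x :
  reflect (exists2 i, 0 < i <= clen j & x = entry T j i) (x \in tcol T j).
Proof.
apply: (iffP mapP) => -[i hi ->]; exists i => //.
  by move: hi; rewrite mem_rev mem_iota add1n ltnS.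
by rewrite mem_rev mem_iota add1n ltnS.
Qed.

Lemma entry_mono T j i k : semistandard T -> 0 < j -> 0 < i ->
  i < k <= clen j -> entry T j i < entry T j k.
Proof.
move=> /semistandardP[_ h] j0 i0; elim: k => [|k IH] //.
rewrite ltnS leq_eqVlt => /andP[/predU1P[<-|lt] hk]; first by apply: h;
  rewrite ?i0.
apply: ltn_trans (IH _) (h _ _ _ _) => //; lia.
Qed.

Lemma decr_col T j : semistandard T -> 0 < j -> decr (tcol T j).
Proof.
move=> hT j0; rewrite /tcol map_rev rev_sorted.
apply: (@homo_sorted_in _ _ (mem (iota 1 (clen j))) (entry T j) ltn).
- by move=> x y; rewrite !mem_iota !add1n !ltnS => hx hy lt;
    apply: entry_mono; lia.
- by apply/allP.
- exact: iota_ltn_sorted.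
Qed.

Lemma dominated_col T j : semistandard T -> 0 < j ->
  dominated (tcol T j) (tcol T j.+1).
Proof.
move=> /semistandardP[h _] j0 x; rewrite /tcol !count_map !count_rev.
have le := col_len_mono (leqnSn j).
rewrite -(subnKC le) iotaD count_cat; apply: leq_trans (leq_addr _ _).
apply: leq_count_in => i /=; rewrite mem_iota => hi.
by apply: leq_trans; apply: h => //; lia.
Qed.

Lemma sum_boxes (F : nat -> nat -> nat) :
  \sum_(b : box lam) F (bcol b) (brow b) =
  \sum_(j <- iota 1 r) \sum_(i <- iota 1 (clen j)) F j i.
Proof.
pose h b := (bcol b, brow b).
transitivity (\sum_(p <- [seq h b | b <- enum {: box lam}]) F p.1 p.2).
  by rewrite big_map big_enum.
rewrite -(big_allpairs_dep (h := pair) (F := fun p => F p.1 p.2)).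
apply: perm_big; apply: uniq_perm.
- rewrite map_inj_uniq ?enum_uniq // => b b' [e1 e2]; exact: box_inj.
- apply: allpairs_uniq_dep => [|j _|]; rewrite ?iota_uniq //.
  by move=> [j i] [j' i'] _ _ /= [-> ->].
move=> p; apply/mapP/allpairsPdep => [[b _ ->]|[j [i [hj hi ->]]]].
  exists (bcol b), (brow b); rewrite !mem_iota; have := bcol_brow b;
    have := bcol_le b.
  by split=> //; lia.
move: hj hi; rewrite !mem_iota => hj hi.
have [||b [<- <-]] := @box_exists j i; try lia.
by exists b; rewrite ?mem_enum.
Qed.

End Tableaux.

(** * Crystal operators *)

Section FirstLastMax.
Variable h : nat -> int.
Local Open Scope ring_scope.

Fixpoint first_max r : nat :=
  if r is r'.+1 then if h (first_max r') < h r then r else first_max r' else 0.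

Fixpoint last_max r : nat :=
  if r is r'.+1 then if h (last_max r') <= h r then r else last_max r' else 0.

Lemma first_maxP r : (first_max r <= r)%N /\
  (forall k, (k <= r)%N -> h k <= h (first_max r)) /\
  (forall k, (k < first_max r)%N -> h k < h (first_max r)).
Proof.
elim: r => [|r [h1 [h2 h3]]]; first by split=> //; split=> // k; case: k.
rewrite [first_max _]/=; case: ifP => [lt|/negbT]; last rewrite -leNgt => le.
  split=> //; split=> k; rewrite ?ltnS.
    by rewrite leq_eqVlt => /predU1P[->//|/h2]; lia.
  by move/h2; lia.
split; [lia | split=> // k]; rewrite leq_eqVlt => /predU1P[->//|/h2]; lia.
Qed.

Lemma last_maxP r : (last_max r <= r)%N /\
  (forall k, (k <= r)%N -> h k <= h (last_max r)) /\
  (forall k, (last_max r < k <= r)%N -> h k < h (last_max r)).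
Proof.
elim: r => [|r [h1 [h2 h3]]].
  by split=> //; split=> k; [case: k | lia].
rewrite [last_max _]/=; case: ifP => [le|/negbT]; last rewrite -ltNge => lt.
  split=> //; split=> k; last by lia.
  by rewrite leq_eqVlt => /predU1P[->//|/h2]; lia.
split; first by lia.
split=> k; first by rewrite leq_eqVlt => /predU1P[->|/h2]; lia.
move=> /andP[k1]; rewrite leq_eqVlt => /predU1P[->//|k2]; apply: h3; lia.
Qed.

Lemma first_max_eq r j : (j <= r)%N -> (forall k, (k <= r)%N -> h k <= h j) ->
  (forall k, (k < j)%N -> h k < h j) -> first_max r = j.
Proof.
move=> jr h1 h2; have [h3 [h4 h5]] := first_maxP r.
by case: (ltngtP (first_max r) j) => // lt; [have := h2 _ lt;
  have := h4 _ jr | have := h5 _ lt; have := h1 _ h3]; lia.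
Qed.

Lemma last_max_eq r j : (j <= r)%N -> (forall k, (k <= r)%N -> h k <= h j) ->
  (forall k, (j < k <= r)%N -> h k < h j) -> last_max r = j.
Proof.
move=> jr h1 h2; have [h3 [h4 h5]] := last_maxP r.
case: (ltngtP (last_max r) j) => // lt.
  by have := h5 j; have := h1 _ h3; rewrite lt jr => ? /(_ isT); lia.
by have := h2 (last_max r); have := h4 _ jr; rewrite lt h3 => ? /(_ isT); lia.
Qed.

End FirstLastMax.

Lemma swap_inj v : injective (swap v).
Proof. exact: inv_inj (swapK v). Qed.

Lemma swap_ltn v x y : x < y -> ~~ ((x == v) && (y == v.+1)) ->
  swap v x < swap v y.
Proof.
rewrite /swap negb_and; case: (x =P v) => ?; case: (x =P v.+1) => ?;
 case: (y =P v) => ?; case: (y =P v.+1) => ? //=; lia.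
Qed.

Lemma mem_toggle v s x : (x \in toggle v s) = (swap v x \in s).
Proof.
rewrite /toggle; case: ifP => h; first by rewrite -{1}[x](swapK v) (mem_map
  (@swap_inj v)).
rewrite /swap; case: eqP => [->|_]; last case: eqP => [->|//].
  by case: (v \in s) h => //=; case: (v.+1 \in s).
by case: (v \in s) h => //=; case: (v.+1 \in s).
Qed.

Lemma swap_l v : swap v v = v.+1.
Proof. by rewrite /swap eqxx. Qed.

Lemma swap_r v : swap v v.+1 = v.
Proof. by rewrite -[RHS](swapK v) swap_l. Qed.

Lemma toggleK v : involutive (toggle v).
Proof.
move=> s; rewrite {1}/toggle !mem_toggle swap_l swap_r addbC.
rewrite /toggle; case: ifP => h; rewrite h // -map_comp map_id_in // => x _;
  apply: swapK.
Qed.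

Section Crystal.
Variables (n : nat) (lam : n.-tuple nat).
Variable i : 'I_n.-1.
Local Notation r := (row_len lam 1).
Local Notation clen := (col_len lam).
Local Notation v := (i : nat).+1.
Implicit Types (T : filling lam) (b : box lam).

Lemma adj_swap (x : 'I_n) : (adj i x).+1 = swap v x.+1.
Proof.
rewrite /adj /swap !eqSS permE /=.
have -> : (x == idx i) = (x == i :> nat) by [].
have -> : (x == idxS i) = (x == v :> nat) by [].
case: eqP => [_|_] /=; [by []|]; case: eqP => _ /=; by [].
Qed.

Definition flip T (j : nat) : filling lam :=
  [ffun b : box lam => if (bcol b == j) && ((v \in tcol T j) (+) (v.+1 \in tcol
    T j))
             then adj i (T b) else T b].

Lemma entry_flip T j c k :
  entry (flip T j) c k =
  if (c == j) && ((v \in tcol T j) (+) (v.+1 \in tcol T j))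
  then swap v (entry T c k) else entry T c k.
Proof.
rewrite /entry; case: pickP => [b /andP[/eqP<- _]|_].
  by rewrite ffunE; case: ifP => // _; rewrite adj_swap.
by case: ifP.
Qed.

Lemma col_flip T j c :
  tcol (flip T j) c = if c == j then toggle v (tcol T j) else tcol T c.
Proof.
rewrite /tcol; case: eqP => [->|ne].
  rewrite /toggle -/(tcol T j); case: ifP => h.
    by rewrite /tcol -map_comp; apply: eq_map => k /=;
      rewrite entry_flip eqxx h.
  by apply: eq_map => k; rewrite entry_flip eqxx h.
by apply: eq_map => k; rewrite entry_flip; case: eqP.
Qed.

Lemma flipK T j : flip (flip T j) j = T.
Proof.
apply/ffunP => b; rewrite !ffunE col_flip eqxx !mem_toggle swap_l swap_r addbC.
by case: ifP => h; rewrite h // /adj tpermK.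
Qed.

Definition sgc T j : int := ((v \in tcol T j)%:Z - (v.+1 \in tcol T j)%:Z)%R.

(* The lattice path of the signature rule: a column [i] without [i+1] is an up
   step, a column [i+1] without [i] a down step, and a down step is bracketed with
   a later up step.  The unbracketed up steps are the new records of the path. *)
Fixpoint hgt T j : int := if j is k.+1 then (hgt T k + sgc T j)%R else 0%R.

Lemma sgc_flip T j c : sgc (flip T j) c = if c == j then (- sgc T j)%R else sgc
  T c.
Proof.
by rewrite /sgc col_flip; case: eqP => // _; rewrite !mem_toggle swap_l swap_r
  opprB.
Qed.

Lemma hgt_flip T j c : 0 < j ->
  hgt (flip T j) c = (hgt T c - (if (j <= c)%N then 2 * sgc T j else 0))%R.
Proof.
move=> j0; elim: c => [|c IH]; first by rewrite leqNgt j0.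
rewrite /= IH sgc_flip; case: (ltngtP j c.+1) => h; last subst j.
- by rewrite -ltnS h; lia.
- by rewrite leqNgt (ltn_trans (ltnSn c) h) /=; lia.
- by rewrite ltnn; lia.
Qed.

(** The path first reaches its maximum with its last record, the rightmost unbracketed up step; the
    step after its last maximum is the leftmost unbracketed down step. Thus [phi] and [eps] count
    the unbracketed steps of each kind, and [fop] and [eop] are the crystal operators. The path
    starts at height 0, so the absolute values change no sign. *)
Definition fmax T := first_max (hgt T) r.
Definition lmax T := last_max (hgt T) r.
Definition phi T : nat := `|hgt T (fmax T)|.
Definition eps T : nat := `|hgt T (fmax T) - hgt T r|.
Definition fop T := flip T (fmax T).
Definition eop T := flip T (lmax T).+1.

Lemma phiE T : Posz (phi T) = hgt T (fmax T).
Proof. by have [_ [/(_ 0 isT) h _]] := first_maxP (hgt T) r; move: h;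
  rewrite /phi /fmax /=; lia. Qed.

Lemma epsE T : Posz (eps T) = (hgt T (fmax T) - hgt T r)%R.
Proof. by have [_ [/(_ r (leqnn r)) h _]] := first_maxP (hgt T) r;
  rewrite /eps /fmax; lia. Qed.

Lemma hgt_lmax T : hgt T (lmax T) = hgt T (fmax T).
Proof.
have [h1 [h2 _]] := first_maxP (hgt T) r; have [h3 [h4 _]] := last_maxP (hgt T)
  r.
by have := h2 _ h3; have := h4 _ h1; rewrite /lmax /fmax; lia.
Qed.

Lemma plus_sgc T j : plus v (tcol T j) = (sgc T j == 1%R).
Proof. by rewrite /plus /sgc; case: (v \in _); case: (v.+1 \in _). Qed.

Lemma minus_sgc T j : minus v (tcol T j) = (sgc T j == (-1)%R).
Proof. by rewrite /minus /sgc; case: (v \in _); case: (v.+1 \in _). Qed.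

Lemma sgc_bound T j : (-1 <= sgc T j <= 1)%R.
Proof. by rewrite /sgc; case: (v \in _); case: (v.+1 \in _). Qed.

Lemma fmax_gt0 T : 0 < phi T -> 0 < fmax T.
Proof. by rewrite /phi; case: fmax. Qed.

Lemma fmax_plus T : 0 < phi T -> sgc T (fmax T) = 1%R.
Proof.
move=> h0; have := fmax_gt0 h0.
have [_ [_]] := first_maxP (hgt T) r; rewrite -/(fmax T).
case: (fmax T) => // j /(_ j (ltnSn j)) /=; have := sgc_bound T j.+1; lia.
Qed.

Lemma lmax_lt T : 0 < eps T -> lmax T < r.
Proof.
move=> h0; have [h1 _] := last_maxP (hgt T) r; rewrite ltn_neqAle h1 andbT.
by apply/eqP => e; have := hgt_lmax T; have := epsE T; rewrite e; lia.
Qed.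

Lemma lmax_minus T : 0 < eps T -> sgc T (lmax T).+1 = (-1)%R.
Proof.
move=> h0; have lt := lmax_lt h0.
have [_ [_ /(_ (lmax T).+1)]] := last_maxP (hgt T) r.
rewrite -/(lmax T) ltnSn lt => /(_ isT) /=; have := sgc_bound T (lmax T).+1;
  lia.
Qed.

Lemma hgt_fop T c : 0 < phi T ->
  hgt (fop T) c = (hgt T c - (if (fmax T <= c)%N then 2 else 0))%R.
Proof. by move=> h0; rewrite hgt_flip ?fmax_gt0 // fmax_plus. Qed.

Lemma hgt_eop T c : 0 < eps T ->
  hgt (eop T) c = (hgt T c + (if (lmax T < c)%N then 2 else 0))%R.
Proof. by move=> h0; rewrite hgt_flip // lmax_minus //; case: ifP => _;
  lia. Qed.

(** The flip lowers the path by 2 from [fmax T] on. The point just before, one below the old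
    maximum, thereby becomes the last maximum, so that [eop] flips the same column back. *)
Lemma lmax_fop T : 0 < phi T -> (lmax (fop T)).+1 = fmax T.
Proof.
move=> h0; have j0 := fmax_gt0 h0; have s1 := fmax_plus h0.
have [h1 [h2 h3]] := first_maxP (hgt T) r.
rewrite -/(fmax T) in h1 h2 h3.
case: (fmax T) j0 s1 h1 h2 h3 (@hgt_fop T ^~ h0) => // j _ s1 h1 h2 h3 H.
congr _.+1; apply: last_max_eq; first by lia.
  move=> k hk; rewrite !H ltnn; case: ifP => hk'; first by have := h2 _ hk;
    move: s1 => /=; lia.
  by have := h3 k; rewrite ltnNge hk' => /(_ isT) /=; lia.
by move=> k /andP[k1 k2]; rewrite !H ltnn k1; have := h2 _ k2; move: s1 => /=;
  lia.
Qed.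

Lemma fmax_eop T : 0 < eps T -> fmax (eop T) = (lmax T).+1.
Proof.
move=> h0; have lt := lmax_lt h0; have s1 := lmax_minus h0.
have [h1 [h2 h3]] := last_maxP (hgt T) r.
rewrite -/(lmax T) in h1 h2 h3.
apply: first_max_eq => // k hk; rewrite !hgt_eop // ltnSn /= s1.
  by have := h2 _ hk; case: ifP => hk'; last lia; have := h3 k;
    rewrite hk hk' => /(_ isT); lia.
have -> : (lmax T < k) = false by lia.
by have := h2 k; lia.
Qed.

Lemma fopK T : 0 < phi T -> eop (fop T) = T.
Proof. by move=> h0; rewrite /eop lmax_fop // flipK. Qed.

Lemma eopK T : 0 < eps T -> fop (eop T) = T.
Proof. by move=> h0; rewrite /fop fmax_eop // flipK. Qed.

Lemma hgt_fmax_fop T : 0 < phi T ->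
  hgt (fop T) (fmax (fop T)) = (hgt T (fmax T) - 1)%R.
Proof.
move=> h0; rewrite -hgt_lmax hgt_fop //.
by have := fmax_plus h0; rewrite -(lmax_fop h0) ltnn /= => ->; lia.
Qed.

Lemma phi_fop T : 0 < phi T -> (phi (fop T)).+1 = phi T.
Proof.
move=> h0; have := phiE (fop T); have := phiE T; rewrite hgt_fmax_fop //; lia.
Qed.

Lemma eps_fop T : 0 < phi T -> eps (fop T) = (eps T).+1.
Proof.
move=> h0; have := epsE (fop T); have := epsE T;
  rewrite hgt_fmax_fop // hgt_fop //.
by have [h1 _] := first_maxP (hgt T) r; rewrite -/(fmax T) in h1; rewrite h1;
  lia.
Qed.

Lemma eps_eop T : 0 < eps T -> (eps (eop T)).+1 = eps T.
Proof.
move=> h0; have := epsE (eop T); have := epsE T;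
  rewrite fmax_eop // !hgt_eop //.
by rewrite ltnSn lmax_lt //= lmax_minus // hgt_lmax; lia.
Qed.

Lemma phi_eop T : 0 < eps T -> phi (eop T) = (phi T).+1.
Proof.
move=> h0; have := phiE (eop T); have := phiE T;
  rewrite fmax_eop // !hgt_eop //.
by rewrite ltnSn /= lmax_minus // hgt_lmax; lia.
Qed.

Hypothesis hlam : is_partition lam.

Lemma col_nil T j : r < j -> tcol T j = [::].
Proof.
move=> h; apply/nilP; rewrite /nilp size_col //.
by have := @col_len_gt0 _ _ hlam j; lia.
Qed.

(** Raising v can only fail against a v on its right in the same row. That column then has v+1 just
    below its v, which forces v+1 below the v of column [j], against [plus]. Lowering v+1 is the
    mirror image, with the column on the left. *)
Lemma semistandard_flip T j : semistandard T -> 0 < j ->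
  (plus v (tcol T j) /\ ~~ plus v (tcol T j.+1)) \/
  (minus v (tcol T j) /\ (1 < j -> ~~ minus v (tcol T j.-1))) ->
  semistandard (flip T j).
Proof.
move=> hT j0 H; have /(semistandardP hlam)[h1 h2] := hT.
have mono := col_len_mono lam.
have memc c k : 0 < k <= clen c -> entry T c k \in tcol T c.
  by move=> hk; apply/mem_colP; exists k.
have x1 : (v \in tcol T j) (+) (v.+1 \in tcol T j).
  by case: H => -[/andP[-> /negPf ->]].
apply/(semistandardP hlam); split => c k c0 hk; rewrite !entry_flip x1 !andbT.
  have le := h1 c k c0 hk; have lec := mono c c.+1 (leqnSn c).
  have [ec|nec] := eqVneq c j.
    subst c; rewrite (_ : (j.+1 == j) = false) ?(gtn_eqF (ltnSn j)) //.
    case: H => -[/andP[inj ninj]].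
      move=> np; rewrite /swap; case: eqP => [e|_]; last first.
        by case: eqP => // e; case/negP: ninj; rewrite -e memc //; lia.
      rewrite ltn_neqAle -{2}e le andbT; apply/eqP => e'.
      (* Column [j.+1] contains v, hence v+1 as well; this bounds its entry in row [k.+1] by v+1. *)
      have vc : v \in tcol T j.+1 by rewrite e' memc.
      move: np; rewrite /plus vc negbK => /mem_colP[k' hk' e2].
      have lt : k < k'.
        rewrite ltnNge leq_eqVlt; apply/negP => /predU1P[ek|lt];
          first by move: e2; rewrite ek -e'; lia.
        by have := @entry_mono _ _ hlam T j.+1 k' k hT; lia.
      have le2 : entry T j.+1 k.+1 <= v.+1.
        move: (lt); rewrite leq_eqVlt e2 => /predU1P[->//|lt'].
        by have := @entry_mono _ _ hlam T j.+1 k.+1 k' hT; lia.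
      have := h1 j k.+1 j0; have := h2 j k j0; rewrite e => a1 a2.
      have e3 : entry T j k.+1 = v.+1 by lia.
      by case/negP: ninj; rewrite -e3 memc //; lia.
    move=> _; rewrite /swap; case: eqP => [e|_]; last case: eqP => [e|//];
      last by lia.
    by case/negP: ninj; rewrite -e memc //; lia.
  have [ec|nec'] := eqVneq c.+1 j; last by [].
  subst j; case: H => -[/andP[inj ninj]].
    move=> _; rewrite /swap; case: eqP => [e|_]; first by lia.
    by case: eqP => // e; case/negP: ninj; rewrite -e memc.
  move=> /(_ c0) /= np; rewrite /swap; case: eqP => [e|_].
    by case/negP: ninj; rewrite -e memc.
  case: eqP => [e|//].
  suff : entry T c k <> v.+1 by lia.
  move=> e'; have vc : v.+1 \in tcol T c by rewrite -e' memc //; lia.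
  move: np; rewrite /minus vc negbK => /mem_colP[k' hk' e2].
  have lt : k' < k.
    rewrite ltnNge leq_eqVlt; apply/negP => /predU1P[ek|lt];
      first by move: e2; rewrite -ek e'; lia.
    by have := @entry_mono _ _ hlam T c k k' hT; lia.
  have le2 : v <= entry T c k.-1.
    have [->|ne] := eqVneq k.-1 k'; first by rewrite e2.
    by have := @entry_mono _ _ hlam T c k' k.-1 hT; lia.
  have := h1 c k.-1 c0; have := h2 c.+1 k.-1; rewrite prednK ?e; last by lia.
  move=> a1 a2; have e3 : entry T c.+1 k.-1 = v by lia.
  by case/negP: ninj; rewrite -e3 memc //; lia.
have lt := h2 c k c0 hk; case: eqP => [ec|//]; subst c.
have m1 := memc j k; have m2 := memc j k.+1.
have {}m1 : entry T j k \in tcol T j by apply: m1; lia.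
have {}m2 : entry T j k.+1 \in tcol T j by apply: m2; lia.
have [x xv xn] : exists2 x, (x == v) || (x == v.+1) & x \notin tcol T j.
  by case: H => -[/andP[inj ninj] _]; [exists v.+1 | exists v];
    rewrite ?eqxx ?orbT.
have n1 : entry T j k <> x by move=> e; rewrite -e m1 in xn.
have n2 : entry T j k.+1 <> x by move=> e; rewrite -e m2 in xn.
apply: swap_ltn => //; apply/negP => /andP[/eqP e1 /eqP e2].
by case/orP: xv => /eqP e; [case: n1 | case: n2]; rewrite e.
Qed.

Lemma sgc_out T j : r < j -> sgc T j = 0%R.
Proof. by move=> h; rewrite /sgc col_nil. Qed.

Lemma fmax_next T : ~~ plus v (tcol T (fmax T).+1).
Proof.
rewrite plus_sgc; have [h1 [h2 _]] := first_maxP (hgt T) r.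
have [h|h] := ltnP (fmax T) r; last by rewrite sgc_out.
have /= := h2 _ h; rewrite -/(fmax T); lia.
Qed.

Lemma fop_semistandard T : semistandard T -> 0 < phi T -> semistandard (fop T).
Proof.
move=> hT h0; apply: semistandard_flip => //; first exact: fmax_gt0.
by left; rewrite plus_sgc fmax_plus // fmax_next.
Qed.

Lemma eop_semistandard T : semistandard T -> 0 < eps T -> semistandard (eop T).
Proof.
move=> hT h0; apply: semistandard_flip => //.
right; rewrite minus_sgc lmax_minus //; split=> // h1.
have [h3 [h2 _]] := last_maxP (hgt T) r; move: h1 h2 h3;
  rewrite -/(lmax T) minus_sgc ltnS /=.
by case: (lmax T) => // j _ /(_ j) /= h2 h3; have := h2 (ltnW h3); lia.
Qed.

(** * The right key along a string *)

Fixpoint kcol T l d : seq nat :=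
  if d is e.+1 then absorb (kcol T l e) (tcol T (l + d)) else tcol T l.

(* Column [l] of the right key of [T]. *)
Definition rkey T l := kcol T l (r - l).

Section Keys.
Variable T : filling lam.
Hypothesis hT : semistandard T.

Lemma kcol_decr l d : 0 < l -> decr (kcol T l d).
Proof.
move=> l0; elim: d => [|d IH] /=; first exact: decr_col.
by apply: absorb_decr => //; apply: decr_col => //; rewrite addnS.
Qed.

(** The two claims feed each other: a slid column that contains the last column crossed dominates
    the next one, and therefore absorbs all of it. *)
Lemma kcol_dominated_sub l d : 0 < l ->
  {subset tcol T (l + d) <= kcol T l d} /\ dominated (kcol T l d) (tcol T (l +
    d).+1).
Proof.
move=> l0.
have key e : {subset tcol T (l + e) <= kcol T l e} ->
    dominated (kcol T l e) (tcol T (l + e).+1).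
  move=> sub x; apply: leq_trans (dominated_col hlam hT _ _) _; first by lia.
  rewrite -!size_filter; apply: uniq_leq_size.
    by rewrite filter_uniq // decr_uniq // decr_col //; lia.
  by move=> y; rewrite !mem_filter => /andP[-> /sub].
elim: d => [|d [IH1 IH2]].
  have sub : {subset tcol T (l + 0) <= kcol T l 0} by rewrite addn0.
  by split=> //; apply: key.
have sub : {subset tcol T (l + d.+1) <= kcol T l d.+1}.
  rewrite /= addnS; apply: sub_absorb => //; first exact: kcol_decr.
  exact: decr_col.
by split=> //; apply: key.
Qed.

(** Column [l], slid past column [l.+1], contains it; by [absorb_mono] the inclusion persists past
    the later columns. *)
Lemma kcol_nested l d : 0 < l -> {subset kcol T l.+1 d <= kcol T l d.+1}.
Proof.
move=> l0; elim: d => [|d IH].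
  by have [+ _] := kcol_dominated_sub 1 l0; rewrite /= addn1.
rewrite [kcol T l.+1 _]/= [kcol T l d.+2]/= addSnnS.
by apply: absorb_mono IH; apply: kcol_decr.
Qed.

Lemma rkey_nested l l' : 0 < l -> l <= l' <= r -> {subset rkey T l' <= rkey T
  l}.
Proof.
move=> l0 /andP[]; elim: l' => [|l' IH]; first by lia.
rewrite leq_eqVlt => /predU1P[-> _ x //|]; rewrite ltnS => h1 h2 x hx.
 apply: IH => //; first by lia.
rewrite /rkey (_ : r - l' = (r - l'.+1).+1); last by lia.
by apply: kcol_nested => //; lia.
Qed.

(** The hypothesis, which includes the height [l] before the first column, says that every down step
    of the stretch is bracketed inside it. Its last step is thus not down: an up step brings v into
    the column, and a level step passes the hypothesis on to the shorter stretch. *)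
Lemma minus_kcol l d :
  (forall k, l <= k <= l.+1 + d -> (hgt T k <= hgt T (l.+1 + d))%R) ->
  ~~ minus v (kcol T l.+1 d).
Proof.
elim: d => [|d IH] H.
  by rewrite minus_sgc; have := H l ltac:(lia); rewrite addn0 /=; lia.
have h k : l <= k <= l + d.+2 -> (hgt T k <= hgt T (l + d).+1 + sgc T (l +
  d).+2)%R.
  by move=> hk; have := H k; rewrite !addSn !addnS /=; apply; lia.
have h0 := h (l + d).+1 ltac:(lia).
have [h1 h2] := @kcol_dominated_sub l.+1 d isT.
rewrite addSn in h1 h2; rewrite [kcol _ _ _]/= addSn addnS;
  apply: absorb_minus => //.
- exact: kcol_decr.
- exact: decr_col.
- by rewrite minus_sgc; lia.
have [p|np] := boolP (plus v (tcol T (l + d).+2)); first by case/andP: p => ->.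
rewrite IH ?orbT // => k hk; rewrite plus_sgc in np;
  have := sgc_bound T (l + d).+2.
by have := h k ltac:(lia); rewrite addSn; lia.
Qed.

Lemma minus_rkey l : eps T = 0 -> 0 < l <= r -> ~~ minus v (rkey T l).
Proof.
case: l => // l e0 hl; apply: minus_kcol => k; rewrite subnKC // => hk.
have [_ [h _]] := first_maxP (hgt T) r.
by have := h k; have := epsE T; rewrite /fmax; lia.
Qed.

Lemma tcol_fop j : tcol (fop T) j = if j == fmax T then toggle v (tcol T j)
  else tcol T j.
Proof. by rewrite col_flip; case: eqP => // ->. Qed.

Lemma toggle_plus s : plus v s -> toggle v s = map (swap v) s.
Proof. by rewrite /toggle => /andP[-> /negPf->]. Qed.

(** The change of v into v+1 enters with column [fmax T] and then either gets lost for good or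
    persists. It persists only past columns that keep the path at its maximal height; at the end of
    the tableau this means [eps T = 0]. *)
Lemma kcol_fop l d : 0 < phi T -> 0 < l -> l + d <= r ->
  kcol (fop T) l d = kcol T l d \/
  [/\ fmax T <= l + d, hgt T (l + d) = hgt T (fmax T), plus v (kcol T l d) &
      kcol (fop T) l d = map (swap v) (kcol T l d)].
Proof.
move=> h0 l0; have pl := fmax_plus h0; have j0 := fmax_gt0 h0.
have [m1 [m2 m3]] := first_maxP (hgt T) r; rewrite -/(fmax T) in m1 m2 m3.
elim: d => [|d IH] hd.
  rewrite /= tcol_fop addn0; case: eqP => [->|_]; last by left.
  by right; rewrite toggle_plus ?plus_sgc ?pl.
have {IH} IH := IH ltac:(lia); rewrite [kcol (fop T) _ _]/= [kcol T l d.+1]/=.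
have dX := kcol_decr d l0.
have dD : decr (tcol T (l + d.+1)) by apply: decr_col => //; lia.
case: IH => [->|[IH1 IH2 IH3 ->]].
  rewrite tcol_fop; case: eqP => [e|_]; last by left.
  have pD : plus v (tcol T (l + d.+1)) by rewrite e plus_sgc pl.
  rewrite toggle_plus //.
  (* The last step before the first maximum is up and all earlier heights are below the maximum, so
     the height just before column [fmax T] is maximal among them. *)
  have nX : ~~ minus v (kcol T l d).
    case: l l0 {dX hd dD pD} e => // l _ e; apply: minus_kcol => k hk.
    have := m3 k; rewrite -e addnS ltnS => /(_ ltac:(lia)).
    by move: pl; rewrite -e addnS /=; lia.
  by have [->|[h1 h2]] := absorb_swap_r dX dD nX pD; [left|right; split=> //;
    rewrite e].
rewrite tcol_fop; have -> : (l + d.+1 == fmax T) = false by lia.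
have := m2 _ hd; rewrite addnS /= IH2 => hs.
have nD : ~~ plus v (tcol T (l + d).+1) by rewrite plus_sgc; lia.
rewrite addnS in dD.
have [->|[h1 h2 h3]] := absorb_swap_l dX dD IH3 nD; first by left.
right; rewrite h2 h3; split=> //; first by lia.
(* The change survives only if the column lacks v+1. Its step is then not down, nor up by
   maximality. *)
by move: hs; rewrite /sgc (negPf h1) /=; lia.
Qed.

End Keys.

(* Each key column either stays or changes [i] into [i+1]; as the columns of a key
   are nested, these two behaviours cannot occur together. *)
Lemma rkey_fop T : semistandard T -> 0 < phi T ->
  (forall l, 0 < l <= r -> rkey (fop T) l = rkey T l) \/
  (eps T = 0 /\ forall l, 0 < l <= r -> rkey (fop T) l = toggle v (rkey T l)).
Proof.
move=> hT h0.
have K l : 0 < l <= r -> rkey (fop T) l = rkey T l \/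
    [/\ eps T = 0, plus v (rkey T l) & rkey (fop T) l = toggle v (rkey T l)].
  move=> hl; have := @kcol_fop T hT l (r - l) h0; rewrite subnKC; last by lia.
  case/(_ ltac:(lia) (leqnn _)) => [|[_ h1 h2 h3]]; [by left | right].
  by split=> //; [have := epsE T; lia | rewrite toggle_plus].
have [/allP h|/allPn[l hl ne]] := boolP (all (fun l =>
  rkey (fop T) l == rkey T l) (iota 1 r)).
  by left=> l hl; apply/eqP/h; rewrite mem_iota; lia.
rewrite mem_iota add1n ltnS in hl.
have [e|[e0 p1 e1]] := K l hl; first by rewrite e eqxx in ne.
right; split=> // l' hl'; have [e2|[_ p2 e2]] := K l' hl'; last by [].
rewrite e2 [RHS]/toggle; case: ifP => // x; exfalso.
have hT' := fop_semistandard hT h0.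
have m1 : minus v (rkey (fop T) l).
  by rewrite e1 /minus !mem_toggle swap_l swap_r.
case/andP: p1 m1 => a1 a2 /andP[a3 a4].
have [[l0 lr] [l0' lr']] := (andP hl, andP hl').
(* Column [l] has v without v+1 in the old key and v+1 without v in the new one. An unchanged column
   nested inside it contains neither value, and one around it contains both, so toggling does
   nothing there. *)
have [le|lt] := leqP l l'.
  have le2 : l <= l' <= r by rewrite le.
  have s1 := rkey_nested hT l0 le2; have s2 := rkey_nested hT' l0 le2.
  have b1 : v.+1 \notin rkey T l' by apply: contra a2; apply: s1.
  have b2 : v \notin rkey T l' by rewrite -e2; apply: contra a4; apply: s2.
  by rewrite (negPf b1) (negPf b2) in x.
have le2 : l' <= l <= r by rewrite ltnW.
have s1 := rkey_nested hT l0' le2; have s2 := rkey_nested hT' l0' le2.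
by move: x; rewrite (s1 _ a1) -e2 (s2 _ a3).
Qed.
End Crystal.

(** * Symmetric sums over strings *)

Section Weights.
Variables (n : nat) (lam : n.-tuple nat).
Hypothesis hlam : is_partition lam.
Variable i : 'I_n.-1.
Local Notation r := (row_len lam 1).
Local Notation v := (i : nat).+1.
Local Notation fop := (@fop n lam i).
Local Notation eop := (@eop n lam i).
Local Notation phi := (@phi n lam i).
Local Notation eps := (@eps n lam i).
Implicit Types (T : filling lam) (b : box lam).

Definition multiplicity T (x : 'I_n) := #|[set b : box lam | T b == x]|.

Lemma multiplicityE T x : semistandard T ->
  multiplicity T x = \sum_(j <- iota 1 r) (x.+1 \in tcol T j).
Proof.
move=> hT; rewrite /multiplicity -sum1_card big_mkcond /=.
rewrite (eq_bigr (fun b => (entry T (bcol b) (brow b) == x.+1 : nat)));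
  last first.
  by move=> b _; rewrite inE entry_box -[_.+1 == _]/(T b == x);
    case: (T b == x).
rewrite (sum_boxes hlam (fun j k => (entry T j k == x.+1 : nat))).
apply: eq_big_seq => j; rewrite mem_iota => /andP[j0 _].
rewrite -count_uniq_mem; last exact/decr_uniq/decr_col.
rewrite /tcol count_map count_rev -sum1_count [RHS]big_mkcond /=.
by apply: eq_bigr => k _ /=; case: (_ == _).
Qed.

(** The final height of the path is both the difference of the two multiplicities and [phi T] minus
    [eps T]. *)
Lemma multiplicity_strings T : semistandard T ->
  multiplicity T (idx i) + eps T = multiplicity T (idxS i) + phi T.
Proof.
move=> hT; rewrite !multiplicityE //.
suff H m : (hgt i T m + Posz (\sum_(j <- iota 1 m) (v.+1 \in tcol T j)) =
       Posz (\sum_(j <- iota 1 m) (v \in tcol T j)))%R.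
  by have := H r; have := phiE i T; have := epsE i T; rewrite /=; lia.
elim: m => [|m IH]; first by rewrite !big_nil.
rewrite -addn1 iotaD !big_cat !big_seq1 addn1 /= !PoszD -IH add1n /sgc.
by rewrite !addrA addrAC [in RHS]addrAC subrK.
Qed.

Lemma multiplicity_flip T j : semistandard T -> semistandard (flip i T j) ->
  multiplicity (flip i T j) (idx i) + multiplicity (flip i T j) (idxS i) =
    multiplicity T (idx i) + multiplicity T (idxS i) /\
  forall x, x != idx i -> x != idxS i -> multiplicity (flip i T j) x =
    multiplicity T x.
Proof.
move=> hT hT'; split=> [|x x1 x2]; rewrite !multiplicityE // -?big_split /=.
  by apply: eq_bigr => c _; rewrite col_flip; case: eqP => // ->;
    rewrite !mem_toggle swap_l swap_r addnC.
by apply: eq_bigr => c _; rewrite col_flip; case: eqP => // ->;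
  rewrite !mem_toggle swap_id.
Qed.

(** * Sums over strings deprived of their highest elements *)

Section StringSum.
(** The hypotheses say that [A] contains nothing of a string or everything but its [delta] highest
    elements. *)
Variables (A : pred (filling lam)) (delta : nat).
Hypothesis A_sst : forall T, A T -> semistandard T.
Hypothesis A_eps : forall T, A T -> delta <= eps T.
Hypothesis A_fop : forall T, A T -> 0 < phi T -> A (fop T).
Hypothesis A_eop : forall T, A T -> delta < eps T -> A (eop T).

Definition same_multiplicity T T' :=
  multiplicity T' (idx i) + multiplicity T' (idxS i) = multiplicity T (idx i) +
    multiplicity T (idxS i) /\
  forall x, x != idx i -> x != idxS i -> multiplicity T' x = multiplicity T x.

Lemma same_multiplicity_trans T1 T2 T3 :
  same_multiplicity T1 T2 -> same_multiplicity T2 T3 -> same_multiplicity T1 T3.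
Proof.
move=> [h1 h2] [h3 h4]; split; first by rewrite h3.
by move=> x x1 x2; rewrite h4 // h2.
Qed.

Lemma iter_fop k T : A T -> k <= phi T ->
  [/\ A (iter k fop T), phi (iter k fop T) = phi T - k,
      eps (iter k fop T) = eps T + k, iter k eop (iter k fop T) = T &
      same_multiplicity T (iter k fop T)].
Proof.
move=> hT; elim: k => [|k IH] hk; first by rewrite /= subn0 addn0; split.
have [h1 h2 h3 h4 h5] := IH (ltnW hk).
have h0 : 0 < phi (iter k fop T) by rewrite h2; lia.
split.
- exact: A_fop.
- by have := phi_fop h0; rewrite /=; lia.
- by have := eps_fop h0; rewrite /=; lia.
- by rewrite iterSr [iter k.+1 fop T]/= fopK.
- apply: same_multiplicity_trans h5 _; apply: multiplicity_flip;
    first exact: A_sst.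
  by apply: (A_sst (T := fop _)); apply: A_fop.
Qed.

Lemma iter_eop k T : A T -> k <= eps T - delta ->
  [/\ A (iter k eop T), phi (iter k eop T) = phi T + k,
      eps (iter k eop T) = eps T - k, iter k fop (iter k eop T) = T &
      same_multiplicity T (iter k eop T)].
Proof.
move=> hT; elim: k => [|k IH] hk; first by rewrite /= subn0 addn0; split.
have [h1 h2 h3 h4 h5] := IH (ltnW hk).
have h0 : delta < eps (iter k eop T) by rewrite h3; lia.
have h0' : 0 < eps (iter k eop T) by lia.
split.
- exact: A_eop.
- by have := phi_eop h0'; rewrite /=; lia.
- by have := eps_eop h0'; rewrite /=; lia.
- by rewrite iterSr [iter k.+1 eop T]/= eopK.
- apply: same_multiplicity_trans h5 _; apply: multiplicity_flip;
    first exact: A_sst.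
  by apply: (A_sst (T := eop _)); apply: A_eop.
Qed.

(* Reversal of the string of [T], deprived of its [delta] highest elements. *)
Definition reflect_string T :=
  iter (phi T - (eps T - delta)) fop (iter (eps T - delta - phi T) eop T).

(** Reversal exchanges [phi] with [eps - delta]. The sum of the two multiplicities is constant along
    a string and their difference is [phi - eps], which determines both. *)
Lemma reflect_stringP T : A T ->
  [/\ A (reflect_string T), reflect_string (reflect_string T) = T,
      multiplicity (reflect_string T) (idx i) + delta = multiplicity T (idxS i),
      multiplicity (reflect_string T) (idxS i) = multiplicity T (idx i) + delta
        &
      forall x, x != idx i -> x != idxS i -> multiplicity (reflect_string T) x
        = multiplicity T x].
Proof.
move=> hT; have e0 := A_eps hT.
suff [h1 h2 h3 h4 [h5 h6]] : [/\ A (reflect_string T),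
   phi (reflect_string T) = eps T - delta, eps (reflect_string T) = phi T +
     delta,
   reflect_string (reflect_string T) = T & same_multiplicity T (reflect_string
     T)].
  have := multiplicity_strings (A_sst hT); have := multiplicity_strings (A_sst
    h1).
  by split=> //; lia.
have [le|lt] := leqP (eps T - delta) (phi T).
  have e : eps T - delta - phi T = 0 by lia.
  have := @iter_fop (phi T - (eps T - delta)) T hT ltac:(lia).
  rewrite {1}/reflect_string [reflect_string T]/reflect_string e /=.
  set k := phi T - (eps T - delta); case=> h1 h2 h3 h4 h5; split=> //; try lia.
  rewrite /reflect_string h2 h3.
  have -> : phi T - k - (eps T + k - delta) = 0 by lia.
  by have -> : eps T + k - delta - (phi T - k) = k by lia.
have e : phi T - (eps T - delta) = 0 by lia.
have := @iter_eop (eps T - delta - phi T) T hT ltac:(lia).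
rewrite {1}/reflect_string [reflect_string T]/reflect_string e /=.
set k := eps T - delta - phi T; case=> h1 h2 h3 h4 h5; split=> //; try lia.
rewrite /reflect_string h2 h3.
have -> : eps T - k - delta - (phi T + k) = 0 by lia.
by have -> : phi T + k - (eps T - k - delta) = k by lia.
Qed.

Lemma msym_X (s : 'S_n) x : msym s ('X_x : {mpoly int[n]}) = 'X_(s x).
Proof. by rewrite /msym mmapX mmap1U. Qed.

Lemma adj_idx : adj i (idx i) = idxS i. Proof. by rewrite /adj tpermL. Qed.
Lemma adj_idxS : adj i (idxS i) = idx i. Proof. by rewrite /adj tpermR. Qed.

Local Open Scope ring_scope.

(** Writes the extra power as a product over all variables, like [weight], so that exponents can be
    compared one variable at a time. *)
Lemma X_exp x d : ('X_x ^+ d : {mpoly int[n]}) = \prod_(y < n) 'X_y ^+ (d * (y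
  == x)).
Proof.
rewrite (bigD1 x) //= eqxx muln1 big1 ?mulr1 // => y /negPf->.
by rewrite muln0 expr0.
Qed.

(** Reindexing by the reversal works term by term: with the factor ['X_(idx i) ^+ delta], the
    exponents of the two variables are exactly exchanged. *)
Lemma msym_string_sum :
  msym (adj i) ('X_(idx i) ^+ delta * \sum_(T | A T) weight T) =
  'X_(idx i) ^+ delta * \sum_(T | A T) weight T.
Proof.
rewrite rmorphM rmorphXn /= msym_X adj_idx raddf_sum !mulr_sumr.
rewrite [RHS](reindex_onto reflect_string reflect_string) /=; last first.
  by move=> T /reflect_stringP[].
apply: eq_big => [T|T /reflect_stringP[h1 h2 h3 h4 h5]].
  apply/idP/andP => [/reflect_stringP[-> -> _ _ _]//|[h1 /eqP h2]].
  by rewrite -h2; have [] := reflect_stringP h1.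
rewrite /weight rmorph_prod /= (reindex_inj (@perm_inj _ (adj i))) /=.
rewrite !X_exp -!big_split /=; apply: eq_bigr => x _.
rewrite rmorphXn /= msym_X.
have -> : adj i (adj i x) = x by rewrite /adj tpermK.
rewrite -!exprD; congr (_ ^+ _); rewrite -!/(multiplicity _ _).
have ne : idx i != idxS i by rewrite -val_eqE /= (ltn_eqF (ltnSn i)).
have [->|x1] := eqVneq x (idx i).
  by rewrite adj_idx (negPf ne) -h3; lia.
have [->|x2] := eqVneq x (idxS i).
  by rewrite adj_idxS h4; lia.
by rewrite h5 // /adj tpermD // eq_sym.
Qed.

End StringSum.

Local Open Scope ring_scope.

Lemma X_sub_neq0 : ('X_(idx i) - 'X_(idxS i) : {mpoly int[n]}) != 0.
Proof.
rewrite subr_eq0; apply/eqP => /(congr1 (fun p : {mpoly int[n]} =>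
  p@_U_(idx i))).
rewrite !mcoeffXU eqxx (_ : idxS i == idx i = false) //.
by rewrite -val_eqE /= (gtn_eqF (ltnSn i)).
Qed.

(** Put F = P + Q. Then x_i P = x_i F - x_i Q has image x_{i+1} F - x_i Q under s_i; the difference
    is (x_i - x_{i+1}) F, so that [rho i P] is F. *)
Lemma rhobar_eq (P Q : {mpoly int[n]}) :
  msym (adj i) (P + Q) = P + Q ->
  msym (adj i) ('X_(idx i) * Q) = 'X_(idx i) * Q -> rhobar i P = Q.
Proof.
move=> hF hQ; apply: (addrI P); rewrite /rhobar addrCA subrr addr0.
apply: (mulIf X_sub_neq0); rewrite rhoP.
have -> : 'X_(idx i) * P = 'X_(idx i) * (P + Q) - 'X_(idx i) * Q by rewrite
  mulrDr addrK.
rewrite msymB hQ msymM hF msym_X adj_idx opprB addrA subrK.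
by rewrite -mulrBl mulrC.
Qed.

End Weights.

(** * Scanning computes the right key *)

(* A scanning path with current value [c] crosses the columns [Ds]; the result is
   its last value and the columns left after its boxes have been removed. *)
Fixpoint pass c (Ds : seq (seq nat)) : nat * seq (seq nat) :=
  if Ds is D :: Ds' then
    if D is d :: D' then
      if c <= d then ((pass d Ds').1, D' :: (pass d Ds').2)
      else ((pass c Ds').1, D :: (pass c Ds').2)
    else ((pass c Ds').1, D :: (pass c Ds').2)
  else (c, [::]).

Fixpoint scan C (Ds : seq (seq nat)) : seq nat :=
  if C is c :: C' then (pass c Ds).1 :: scan C' (pass c Ds).2 else [::].

(* Whether a path uses a column depends only on its value before that column and
   on the paths started earlier, so that all the paths may cross one column before
   any of them enters the next one. *)
Lemma scan_foldl C Ds : scan C Ds = foldl absorb C Ds.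
Proof.
have scan_cons X D Es : scan X (D :: Es) = scan (absorb X D) Es.
  elim: X D Es => [|c X IH] [|d D] Es //=; first by rewrite IH absorb_nil.
  by case: ifP => _ /=; rewrite IH.
have scan_nil X : scan X [::] = X by elim: X => //= c X ->.
by elim: Ds C => [|D Ds IH] C; rewrite ?scan_nil // scan_cons IH.
Qed.

Section Scanning.
Variables (n : nat) (lam : n.-tuple nat) (T : filling lam).
Local Notation r := (row_len lam 1).
Local Notation clen := (col_len lam).

Definition top_col j k : seq nat := [seq entry T j t | t <- rev (iota 1 k)].

Lemma top_colS j k : top_col j k.+1 = entry T j k.+1 :: top_col j k.
Proof. by rewrite /top_col -{1}[k.+1]addn1 iotaD rev_cat /= add1n. Qed.

Lemma mem_ewis_from (S : eqType) (f : S -> nat) a s :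
  {subset ewis_from f a s <= s}.
Proof.
elim: s a => //= b s IH a x; case: ifP => _; rewrite !inE; last by move/IH->;
  rewrite orbT.
by case/orP => [->|/IH ->]; rewrite ?orbT.
Qed.

(** Matches the recursion on lists with the definition by locations: [pass] beheads exactly the
    columns whose bottom box lies on the path. Since the columns in [s] are distinct, a location
    identifies its column. *)
Lemma pass_path (h : nat -> nat) (s : seq nat) a : uniq s ->
  (pass (entry_at T a) [seq top_col j (h j) | j <- s]).2 =
  [seq top_col j (if (j, h j) \in
        ewis_from (entry_at T) a [seq (j, h j) | j <- s & 0 < h j]
      then (h j).-1 else h j) | j <- s].
Proof.
elim: s a => //= j s IH a /andP[js us].
have out b : (j, h j) \notin ewis_from (entry_at T) b [seq (k, h k) | k <- s &
  0 < h k].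
  apply/negP => /mem_ewis_from /mapP[k]; rewrite mem_filter =>
    /andP[_ ks] [e _].
  by rewrite e ks in js.
case hj : (h j) => [|m] /=; first by rewrite IH // /top_col; case: ifP.
rewrite top_colS /= hj -[entry T j m.+1]/(entry_at T (j, m.+1));
  case: ifP => _ /=.
  rewrite (IH (j, m.+1)) // inE eqxx /=; congr (_ :: _).
  apply/eq_in_map => k ks; rewrite inE xpair_eqE.
  by case: eqP => [e|//]; rewrite -e ks in js.
by rewrite IH // -hj (negPf (out a)) hj top_colS.
Qed.

(** A value skipped by the path is below its current value, so the path ends at the maximum. The
    condition [0 < c] absorbs the default value 1 of the maximum. *)
Lemma pass_max (h : nat -> nat) (s : seq nat) c : 0 < c ->
  (pass c [seq top_col j (h j) | j <- s]).1 =
  maxn c (\big[maxn/1]_(p <- [seq (j, h j) | j <- s & 0 < h j]) entry_at T p).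
Proof.
elim: s c => [|j s IH] c c0 /=; first by rewrite big_nil; apply/esym/maxn_idPl.
case hj : (h j) => [|m] /=; first by rewrite IH.
rewrite top_colS big_cons /entry_at /= hj; case: leqP => h1 /=.
  by rewrite IH ?maxnA ?(maxn_idPr h1) //; apply: leq_trans h1.
by rewrite IH // maxnA (maxn_idPl (ltnW h1)).
Qed.

Section Column.
Variable l : nat.
Hypothesis hl : 0 < l <= r.

Definition later h := [seq top_col j (h j) | j <- iota l.+1 (r - l)].

Lemma bottoms_split (h : nat -> nat) : (forall j, j < l -> h j = 0) ->
  bottoms lam h = (if 0 < h l then [:: (l, h l)] else [::]) ++
    [seq (j, h j) | j <- iota l.+1 (r - l) & 0 < h j].
Proof.
move=> h0; rewrite /bottoms (_ : r = l.-1 + (r - l).+1); last by lia.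
rewrite iotaD filter_cat (_ : 1 + l.-1 = l); last by lia.
rewrite (_ : [seq j <- iota 1 l.-1 | 0 < h j] = [::]) /=.
  by rewrite (_ : l.-1 + (r - l).+1 - l = r - l); [case: ifP | lia].
apply/eqP; rewrite -[_ == _]negbK -has_filter; apply/hasP => -[j].
by rewrite mem_iota => hj; rewrite h0 //; lia.
Qed.

Lemma remove_path_step (h : nat -> nat) k : (forall j, j < l -> h j = 0) -> h l
  = k.+1 ->
  [/\ forall j, j < l -> remove_path T h j = 0, remove_path T h l = k &
      later (remove_path T h) = (pass (entry T l k.+1) (later h)).2].
Proof.
move=> h0 hk; have P : path_of T h = (l, k.+1) :: ewis_from (entry_at T) (l,
  k.+1)
     [seq (j, h j) | j <- iota l.+1 (r - l) & 0 < h j].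
  by rewrite /path_of bottoms_split // hk.
split.
- by move=> j /h0 e; rewrite /remove_path e; case: ifP.
- by rewrite /remove_path hk P inE eqxx.
rewrite /later (pass_path h (l, k.+1)) ?iota_uniq //; apply/eq_in_map => j.
rewrite mem_iota => /andP[hj _]; rewrite /remove_path P inE xpair_eqE.
by rewrite (gtn_eqF hj).
Qed.

(** Invariant of the removals: the first [t] paths from column [l] produce the [t] largest entries
    of its key column, and scanning what is left produces the others. *)
Lemma scanT_rkey t : t <= clen l ->
  let h := scanT T l (clen l - t) in
  [/\ forall j, j < l -> h j = 0, h l = clen l - t &
      scan (top_col l (clen l - t)) (later h) = drop t (rkey T l)].
Proof.
rewrite /scanT; elim: t => [|t IH] ht.
  rewrite !subn0 subnn /= leqnn drop0; split=> // [j lt|];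
    first by rewrite leqNgt lt.
  rewrite scan_foldl /rkey /later.
  have -> : [seq top_col j (if l <= j then clen j else 0) | j <- iota l.+1 (r -
    l)] =
            [seq tcol T j | j <- iota l.+1 (r - l)].
    by apply/eq_in_map => j; rewrite mem_iota => /andP[/ltnW -> _].
  elim: (r - l) => // d IH; rewrite -[d.+1]addn1 iotaD map_cat foldl_cat IH /=
    !addn1.
  by rewrite /= addSn addnS.
have [] := IH (ltnW ht); have -> : clen l - t = (clen l - t.+1).+1 by lia.
rewrite (_ : clen l - (clen l - t.+1) = (clen l - (clen l - t.+1).+1).+1);
  last by lia.
move=> h1 h2 h3; have [g1 g2 g3] := remove_path_step h1 h2.
split=> //; rewrite [later _]g3; move: h3; rewrite top_colS /= => h3.
by rewrite -add1n -drop_drop -h3 /= drop0.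
Qed.

(** The left side is the last value of the path from (l,k). Key columns are read from the bottom,
    which turns row [k] into the index [clen l - k]. *)
Lemma max_scanU k : is_partition lam -> 0 < k <= clen l ->
  maxn (entry T l k) (max_bottom T (scanU T l k)) = nth 0 (rkey T l) (clen l -
    k).
Proof.
move=> hlam hk; have [] := @scanT_rkey (clen l - k) ltac:(lia).
rewrite subKn; last by lia.
case: k hk => // k hk; set h := scanT _ _ _ => h1 h2; rewrite top_colS /= => h3.
have e0 : 0 < entry T l k.+1.
  by rewrite entry_gt0 // hk andbT; case/andP: hl.
rewrite -[clen l - k.+1]addn0 -nth_drop -h3 /= pass_max //.
congr maxn; rewrite /max_bottom bottoms_split /scanU ?eqxx => [|j lt];
  last first.
  by rewrite -/h h1 //; case: eqP.
rewrite /= -/h.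
have H : {in iota l.+1 (r - l), (fun j => if j == l then 0 else h j) =1 h}.
  by move=> j; rewrite mem_iota => /andP[lj _]; rewrite (gtn_eqF lj).
rewrite (@eq_in_filter _ _ (fun j => 0 < h j)); last by move=> j /H /= ->.
congr (\big[maxn/1]_(p <- _) entry_at T p); apply/eq_in_map => j.
by rewrite mem_filter => /andP[_ /H /= ->].
Qed.

End Column.
End Scanning.

(** * The sets C expressed by the right key *)

Section KeyCondition.
Variables (n : nat) (lam : n.-tuple nat).
Hypothesis hlam : is_partition lam.
Local Notation r := (row_len lam 1).
Local Notation clen := (col_len lam).

Lemma leq_entry (T : filling lam) j k : semistandard T -> 0 < j ->
  0 < k <= clen j -> k <= entry T j k.
Proof.
move=> /(semistandardP hlam)[_ h] j0; elim: k => // k IH hk.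
case: k IH hk => [|k] IH hk; first by rewrite entry_gt0 ?j0.
by apply: leq_ltn_trans (IH _) (h _ _ _ _) => //; lia.
Qed.

(* The bounds in [Cset] other than [Y(l,k)] hold for every semistandard tableau. *)
Lemma mem_Cset (T : filling lam) (pi : 'S_n) l k : semistandard T ->
  0 < l <= r -> 0 < k <= clen l ->
  (entry T l k \in Cset T pi l k) =
  (maxn (entry T l k) (max_bottom T (scanU T l k)) == key lam pi l k).
Proof.
move=> hT hl hk; have /(semistandardP hlam)[h1 h2] := hT.
have l0 : 0 < l by case/andP: hl.
have ge1 : k <= entry T l k by apply: leq_entry.
have e0 : 0 < entry T l k by rewrite entry_gt0 ?l0.
have lt_below : entry T l k <= below_val T l k - 1.
  rewrite /below_val; case: eqP => [_|ne]; first by rewrite subn1;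
    apply: entry_le.
  by have := h2 l k l0; lia.
have le_right : entry T l k <= right_val T l k.
  rewrite /right_val; case: eqP => [_|ne]; first exact: entry_le.
  apply: h1 => //; have := @leq_row_len _ _ hlam l k;
    have := @leq_row_len _ _ hlam l.+1 k; lia.
rewrite /Cset; set m := max_bottom _ _; set y := key _ _ _ _.
case: eqP => [e|_].
  (* In the last column U is empty, and its conventional maximum 1 does not exceed T(l,k). *)
  have -> : m = 1.
    have hm : maxn (entry T l k) m = nth 0 (rkey T l) (clen l - k) by apply:
      max_scanU.
    rewrite /m /max_bottom /bottoms (_ : [seq _ <- _ | _] = [::]) ?big_nil //.
    apply/eqP; rewrite -[_ == _]negbK -has_filter; apply/hasP => -[j].
    rewrite mem_iota /scanU => hj; case: eqP => // ne.
    have [h _ _] := @scanT_rkey _ _ T l hl (clen l - k) ltac:(lia).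
    by rewrite subKn in h; [rewrite h //; lia | lia].
  by rewrite inE (maxn_idPl e0).
(* The maximum of T(l,k) and m equals Y(l,k) never if m > Y(l,k), only for T(l,k) = Y(l,k) if m <
   Y(l,k), and for all T(l,k) up to Y(l,k) if they are equal. *)
case: ltngtP => [lt|gt|e]; rewrite inE.
- by apply/esym/eqP; lia.
- rewrite ge1 leq_min lt_below le_right !andbT.
  by apply/eqP/eqP; lia.
- rewrite ge1 !leq_min lt_below le_right !andbT /=.
  by apply/idP/eqP; lia.
Qed.

Definition key_col (pi : 'S_n) l : seq nat :=
  rev (sort leq (take (clen l) (one_line pi))).

Lemma size_key_col pi l : size (key_col pi l) = clen l.
Proof.
rewrite size_rev size_sort size_takel // size_map size_enum_ord.
exact: col_len_le.
Qed.

Lemma size_rkey (T : filling lam) l : size (rkey T l) = clen l.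
Proof.
rewrite /rkey; elim: (r - l) => [|d IH] /=; first exact: size_col.
by rewrite size_absorb.
Qed.

Definition has_key (pi : 'S_n) (T : filling lam) :=
  all (fun l => rkey T l == key_col pi l) (iota 1 r).

Lemma has_keyP pi T :
  reflect (forall l, 0 < l <= r -> rkey T l = key_col pi l) (has_key pi T).
Proof.
apply: (iffP allP) => [h l hl|h l]; first by apply/eqP/h;
  rewrite mem_iota add1n.
by rewrite mem_iota add1n => /h ->.
Qed.

Lemma Cset_has_key (T : filling lam) pi : semistandard T ->
  [forall b : box lam, entry T (bcol b) (brow b) \in Cset T pi (bcol b) (brow
    b)] =
  has_key pi T.
Proof.
move=> hT.
have key_nth l k : 0 < k <= clen l -> key lam pi l k = nth 0 (key_col pi l)
  (clen l - k).
  move=> hk; rewrite /key_col; have := size_key_col pi l;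
    rewrite size_rev => sz.
  rewrite nth_rev sz; last by lia.
  by rewrite /key; congr nth; lia.
apply/forallP/has_keyP => [h l hl|h b].
  apply: (@eq_from_nth _ 0); rewrite size_rkey ?size_key_col // => t ht.
  have hk : 0 < clen l - t <= clen l by lia.
  have [b [e1 e2]] := @box_exists _ _ hlam l _ ltac:(lia) hk.
  have := h b; rewrite e1 e2 mem_Cset // max_scanU // key_nth //.
  by rewrite subKn ?(ltnW ht) // => /eqP.
have hl := bcol_le hlam b; have /andP[l0 hk] := bcol_brow hlam b.
by rewrite mem_Cset // max_scanU // key_nth // h.
Qed.

End KeyCondition.

(** * Reduced words and keys of permutations *)

Section Permutations.
Variable n : nat.
Implicit Types (pi : 'S_n) (w : seq 'I_n.-1).
Local Open Scope group_scope.

Lemma adjV (i : 'I_n.-1) : (adj i)^-1 = adj i.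
Proof. by rewrite /adj tpermV. Qed.

Lemma adjK (i : 'I_n.-1) : adj i * adj i = 1.
Proof. by rewrite /adj tperm2. Qed.

(** The exchange condition: if the value b stands before the smaller value a, exchanging them
    amounts to deleting a letter. Delete the first letter if it exchanges precisely a and b;
    otherwise it preserves their order, and one recurses with the conjugated transposition. *)
Lemma composition_exchange w (a b : 'I_n) : (a < b)%N ->
  ((composition w)^-1 b < (composition w)^-1 a)%N ->
  exists2 w', composition w' = composition w * tperm a b & size w = (size
    w').+1.
Proof.
elim: w a b => [|i w IH] a b ab /=; first by rewrite invg1 !perm1; lia.
rewrite /sact invMg !permM adjV => lt.
have [/andP[/eqP ea /eqP eb]|ne] := boolP ((a.+1 == i.+1) && (b.+1 == i.+2)).
  exists w => //; rewrite -mulgA (_ : tperm a b = adj i) ?adjK ?mulg1 //.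
  by congr tperm; apply: val_inj => /=; lia.
have lt' : (adj i a < adj i b)%N by rewrite -ltnS !adj_swap swap_ltn.
have [w' e1 e2] := IH _ _ lt' lt.
exists (i :: w') => /=; last by rewrite e2.
by rewrite /sact e1 -tpermJ conjgE adjV -!mulgA adjK mulg1.
Qed.

(** If the value i+1 stood before i in [composition w], the exchange condition would give a word for
    [pi] shorter than [w]. *)
Lemma reduced_composition_cons pi i w : reduced_composition pi (i :: w) ->
  [/\ pi = sact i (composition w), reduced_composition (composition w) w &
      ((composition w)^-1 (idx i) < (composition w)^-1 (idxS i))%N].
Proof.
move=> [/= <- hmin]; split=> //.
  by split=> // w' e; have := hmin (i :: w'); rewrite /= e => /(_ erefl).
rewrite ltnNge leq_eqVlt; apply/negP => /predU1P[/val_inj/perm_inj/eqP|lt].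
  by rewrite -val_eqE /= (gtn_eqF (ltnSn i)).
have lti : (idx i < idxS i)%N by rewrite /=.
have [w' e1 e2] := composition_exchange lti lt.
by have := hmin w' e1; rewrite /= e2; lia.
Qed.

Lemma size_one_line pi : size (one_line pi) = n.
Proof. by rewrite size_map size_enum_ord. Qed.

Lemma uniq_one_line pi : uniq (one_line pi).
Proof. by rewrite map_inj_uniq ?enum_uniq // => x y [/val_inj/perm_inj]. Qed.

Lemma nth_one_line pi (x : 'I_n) : nth 0%N (one_line pi) x = (pi x).+1.
Proof. by rewrite (nth_map x) ?size_enum_ord // nth_ord_enum. Qed.

Lemma one_line_sact i pi : one_line (sact i pi) = map (swap i.+1) (one_line pi).
Proof. by rewrite /one_line -[RHS]map_comp; apply: eq_map => x /=;
  rewrite permM adj_swap. Qed.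

Lemma perm_at_sact i pi k : perm_at (sact i pi) k = swap i.+1 (perm_at pi k).
Proof.
rewrite /perm_at one_line_sact; have [lt|le] := ltnP k.-1 n.
  by rewrite (nth_map 0%N) ?size_one_line.
by rewrite [in RHS]nth_default ?size_one_line // nth_default // size_map
  size_one_line.
Qed.

Lemma perm_at_inv pi k (x : 'I_n) : perm_at pi k = x.+1 -> k.-1 = pi^-1 x :>
  nat.
Proof.
rewrite /perm_at; have [lt|le] := ltnP k.-1 n;
  last by rewrite nth_default ?size_one_line.
by rewrite (nth_one_line pi (Ordinal lt)) => -[/val_inj <-]; rewrite permK.
Qed.

Lemma mem_take_one_line pi (x : 'I_n) c :
  (x.+1 \in take c (one_line pi)) = (pi^-1 x < c)%N.
Proof.
have e : nth 0%N (one_line pi) (pi^-1 x) = x.+1 by rewrite nth_one_line permKV.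
by rewrite -{1}e in_take ?mem_nth ?index_uniq ?size_one_line ?uniq_one_line.
Qed.

End Permutations.

Lemma rev_toggle v s : rev (toggle v s) = toggle v (rev s).
Proof. by rewrite /toggle !mem_rev map_rev; case: ifP. Qed.

(** Exchanging neighbouring values keeps a sorted list sorted unless both occur, and then the set of
    values does not change. *)
Lemma sort_swap v s : uniq s -> sort leq (map (swap v) s) = toggle v (sort leq
  s).
Proof.
move=> us; have ps : perm_eq (map (swap v) s) (toggle v (sort leq s)).
  apply: uniq_perm; first by rewrite map_inj_uniq //; apply: swap_inj.
    rewrite /toggle; case: ifP => _; rewrite ?map_inj_uniq ?sort_uniq //.
    exact: swap_inj.
  by move=> x; rewrite mem_toggle mem_sort -{1}[x](swapK v) mem_map //;
    apply: swap_inj.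
rewrite (perm_sortP leq_total leq_trans anti_leq _ _ ps).
apply: (sorted_sort leq_trans); rewrite /toggle !mem_sort.
case: ifP => h; last exact: sort_sorted leq_total _.
apply: (homo_sorted_in (P := mem s) (e := ltn)).
- move=> x y xs ys lt; apply/ltnW/swap_ltn => //;
    apply/negP => /andP[/eqP ex /eqP ey].
  by move: h; rewrite -ey -ex (xs : x \in s) (ys : y \in s).
- by apply/allP => x; rewrite mem_sort.
- by rewrite ltn_sorted_uniq_leq sort_uniq us sort_sorted //; apply: leq_total.
Qed.

Section KeysOfPermutations.
Variables (n : nat) (lam : n.-tuple nat).
Local Notation r := (row_len lam 1).
Local Notation clen := (col_len lam).
Implicit Types (pi : 'S_n) (T : filling lam).

Lemma key_col_sact i pi l : key_col lam (sact i pi) l = toggle i.+1 (key_col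
  lam pi l).
Proof.
by rewrite /key_col one_line_sact -map_take sort_swap ?rev_toggle // take_uniq
  ?uniq_one_line.
Qed.

Lemma mem_key_col pi (x : 'I_n) l : (x.+1 \in key_col lam pi l) = ((pi^-1)%g x
  < clen l).
Proof. by rewrite mem_rev mem_sort mem_take_one_line. Qed.

(** Undoing s_i affects only the order of i and i+1, and puts i first. If both lay in one block,
    s_i.pi would have a descent there; hence a block ends between them, and its end is the length of
    a column with i but not i+1. *)
Lemma in_Slam_sact i pi : in_Slam lam (sact i pi) ->
  ((pi^-1)%g (idx i) < (pi^-1)%g (idxS i)) ->
  in_Slam lam pi /\ exists2 l, 0 < l <= r & plus i.+1 (key_col lam pi l).
Proof.
move=> hS lt.
have inv : ((sact i pi)^-1 = adj i * pi^-1)%g by rewrite /sact invMg adjV.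
have eI : ((sact i pi)^-1)%g (idx i) = (pi^-1)%g (idxS i) by rewrite inv permM
  adj_idx.
have eS : ((sact i pi)^-1)%g (idxS i) = (pi^-1)%g (idx i) by rewrite inv permM
  adj_idxS.
split=> [q s a b hs ha hab hb|].
  have := hS s a b hs ha hab hb; rewrite !perm_at_sact => lt'.
  rewrite -[perm_at pi a](swapK i.+1) -[perm_at pi b](swapK i.+1).
  apply: swap_ltn => //; apply/negP => /andP[/eqP e1 /eqP e2].
  have := @perm_at_inv _ (sact i pi) a (idx i); rewrite perm_at_sact => /(_ e1).
  have := @perm_at_inv _ (sact i pi) b (idxS i);
    rewrite perm_at_sact => /(_ e2).
  by rewrite eI eS; lia.
set p : nat := (pi^-1)%g (idx i) in lt *; set q : nat := (pi^-1)%g (idxS i) in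
  lt *.
have qn : q < n by apply: ltn_ord.
set bs := col_bounds lam.
have hbs : has (fun c => p < c) bs.
  by apply/hasP; exists n; [rewrite inE mem_rcons inE eqxx orbT | lia].
(* Positions are 0-based here: [s] is the block of [p], where q_{s-1} <= p < q_s. *)
pose s := find (fun c => p < c) bs.
have ss : s < size bs by rewrite -has_find.
have ps : p < nth 0 bs s by apply: (nth_find 0 hbs).
have s0 : 0 < s by rewrite lt0n; apply/eqP => e; rewrite e in ps.
have ps' : nth 0 bs s.-1 <= p.
  by rewrite leqNgt (before_find 0 (i := s.-1)) //; rewrite -/s; lia.
have [qs|qs] := ltnP q (nth 0 bs s).
  have := hS s p.+1 q.+1; rewrite -/bs s0 ss addn1 !ltnS => /(_ isT ps' lt qs).
  rewrite !perm_at_sact /perm_at /= !nth_one_line !permKV swap_l swap_r; lia.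
have : nth 0 bs s \in bs by apply: mem_nth.
rewrite {2}/bs /col_bounds inE mem_rcons inE mem_sort mem_undup.
(* The bound exceeds [p] and is at most [q < n], so it is neither 0 nor [n]: it is a column
   length. *)
case/or3P => [/eqP|/eqP|/mapP[l hl e]]; [lia|lia|].
exists l; first by move: hl; rewrite mem_iota; lia.
by rewrite /plus (mem_key_col pi (idx i)) (mem_key_col pi (idxS i)) -/p -/q -e
  ps -leqNgt.
Qed.

Hypothesis hlam : is_partition lam.

(** * The identity permutation and its only tableau *)

Lemma one_line1 : one_line (1%g : 'S_n) = iota 1 n.
Proof.
rewrite /one_line (eq_map (g := succn \o val)); last by move=> x /=;
  rewrite perm1.
by rewrite map_comp val_enum_ord -[1]addn0 iotaDl.
Qed.

Lemma key_col1 l : key_col lam 1%g l = rev (iota 1 (clen l)).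
Proof.
rewrite /key_col one_line1 take_iota (minn_idPl (col_len_le lam l)).
by rewrite (sorted_sort leq_trans) // iota_sorted.
Qed.

Lemma brow_lt (b : box lam) : (brow b).-1 < n.
Proof.
have /and3P[_ h1 h2] := bcol_brow hlam b; have := col_len_le lam (bcol b); lia.
Qed.

Definition row_filling : filling lam := [ffun b : box lam =>
  Ordinal (brow_lt b)].

Lemma entry_row_filling j k : 0 < j -> 0 < k <= clen j -> entry row_filling j k
  = k.
Proof.
move=> j0 hk; have [b [<- <-]] := box_exists hlam j0 hk.
by rewrite entry_box ffunE /= prednK //; have /and3P[] := bcol_brow hlam b.
Qed.

Lemma tcol_row_filling j : 0 < j -> tcol row_filling j = rev (iota 1 (clen j)).
Proof.
move=> j0; rewrite /tcol -[RHS]map_id; apply/eq_in_map => k.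
by rewrite mem_rev mem_iota add1n ltnS => hk; apply: entry_row_filling.
Qed.

Lemma semistandard_row_filling : semistandard row_filling.
Proof.
apply/(semistandardP hlam); split=> j k j0 hk.
  by have le := col_len_mono lam (leqnSn j); rewrite !entry_row_filling //; lia.
by rewrite !entry_row_filling //; lia.
Qed.

Lemma has_key_row_filling : has_key 1%g row_filling.
Proof.
apply/has_keyP => l /andP[l0 _]; rewrite key_col1 /rkey.
have dec c : decr (rev (iota 1 c)) by rewrite rev_sorted iota_ltn_sorted.
elim: (r - l) => [|d IH] /=; first exact: tcol_row_filling.
rewrite IH tcol_row_filling ?absorb_sub // => [x|]; last by lia.
by rewrite !mem_rev !mem_iota !add1n !ltnS => /andP[->] /leq_trans; apply;
  apply/col_len_mono/leq_addr.
Qed.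

Lemma nth_tcol (T : filling lam) j k : 0 < k <= clen j ->
  nth 0 (tcol T j) (clen j - k) = entry T j k.
Proof.
move=> hk; rewrite (nth_map 0) ?size_rev ?size_iota; last by lia.
rewrite nth_rev ?size_iota; last by lia.
by rewrite nth_iota; [congr entry; lia | lia].
Qed.

Lemma leq_rkey (T : filling lam) l k : nth 0 (tcol T l) k <= nth 0 (rkey T l) k.
Proof.
rewrite /rkey; elim: (r - l) => //= d IH; exact: leq_trans IH (leq_absorb _ _
  _).
Qed.

(** Entries lie weakly below those of the right key, here k in row k, and in a semistandard tableau
    no entry of row k is less than k. *)
Lemma has_key1 (T : filling lam) :
  semistandard T && has_key 1%g T = (T == row_filling).
Proof.
apply/andP/eqP => [[hT /has_keyP hk]|->]; last first.
  by rewrite semistandard_row_filling has_key_row_filling.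
apply/ffunP => b; apply/val_inj/succn_inj; rewrite -!entry_box.
have /andP[l0 hb] := bcol_brow hlam b; have hl := bcol_le hlam b.
rewrite entry_row_filling //; apply/eqP; rewrite eqn_leq leq_entry // andbT.
have := leq_rkey T (bcol b) (clen (bcol b) - brow b).
rewrite nth_tcol // hk // key_col1 nth_rev ?size_iota; last by lia.
by rewrite nth_iota; lia.
Qed.

Lemma weight_row_filling :
  weight row_filling = (\prod_(x < n) 'X_x ^+ tnth lam x)%R.
Proof.
apply: eq_bigr => x _; congr (_ ^+ _)%R; rewrite -/(multiplicity _ _).
rewrite (multiplicityE hlam _ semistandard_row_filling).
have -> : tnth lam x = row_len lam x.+1 by rewrite (tnth_nth 0).
have le : row_len lam x.+1 <= r.
  case: (posnP (row_len lam x.+1)) => [->//|x0].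
  by rewrite -(col_len_gt0 hlam) //; have := leq_row_len hlam x0 (ltn0Sn x);
    rewrite leqnn; lia.
transitivity (\sum_(j <- iota 1 r) (j <= row_len lam x.+1 : nat)).
  apply: eq_big_seq => j; rewrite mem_iota => /andP[j0 _].
  by rewrite tcol_row_filling // mem_rev mem_iota add1n ltnS leq_row_len.
rewrite -(subnKC le) iotaD big_cat /= (eq_big_seq (fun=> 1)); last first.
  by move=> j; rewrite mem_iota add1n ltnS => /andP[_ ->].
rewrite [X in _ + X]big1_seq => [|j]; last first.
  by rewrite mem_iota => /andP[_ hj]; rewrite (_ : (j <= _) = false) //; lia.
by rewrite sum1_size size_iota addn0.
Qed.

(** * Induction along a reduced word *)

Lemma atom_has_key pi w : in_Slam lam pi -> reduced_composition pi w ->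
  atom lam w = (\sum_(T : filling lam | semistandard T && has_key pi T) weight
    T)%R.
Proof.
elim: w pi => [|i w IH] pi hS hw.
  have [<- _] := hw; rewrite /= (eq_bigl (pred1 row_filling));
    last exact: has_key1.
  by rewrite big_pred1_eq weight_row_filling.
have [epi hw' lt] := reduced_composition_cons hw; subst pi.
move: (composition w) hS hw hw' lt => tau hS hw hw' lt.
have [hS' [l hl pl]] := in_Slam_sact hS lt.
rewrite -[atom lam (i :: w)]/(rhobar i (atom lam w)) (IH tau hS' hw').
have key_tog m : key_col lam tau m = toggle i.+1 (key_col lam (sact i tau) m).
  by rewrite key_col_sact toggleK.
(* [AF] describes the tableaux counted by P + Q, and [AQ] those counted by Q. *)
pose AF (T : filling lam) := semistandard T && (has_key tau T || has_key (sact
  i tau) T).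
pose AQ (T : filling lam) := semistandard T && has_key (sact i tau) T.
(* Column [l], which contains exactly one of the two values, tells the two keys apart. *)
have sepk (T : filling lam) : has_key tau T -> has_key (sact i tau) T = false.
  move=> /has_keyP/(_ l hl) e; apply/has_keyP => /(_ l hl).
  rewrite e key_col_sact => /(congr1 (fun s : seq nat => i.+1 \in s)).
  by rewrite mem_toggle swap_l; case/andP: pl => -> /negPf->.
(* The key of s_i.tau has i+1 without i in column [l], which no highest element allows. *)
have epsQ (T : filling lam) : AQ T -> 0 < eps i T.
  move=> /andP[hT /has_keyP/(_ l hl) e]; rewrite lt0n; apply/eqP => e0.
  have := minus_rkey hlam hT e0 hl; rewrite e key_col_sact /minus !mem_toggle
    swap_l swap_r.
  by case/andP: pl => -> ->.
have AF_rel (T T' : filling lam) : semistandard T' -> (forall m, 0 < m <= r ->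
  rkey T' m = rkey T m) \/
    (forall m, 0 < m <= r -> rkey T' m = toggle i.+1 (rkey T m)) -> AF T -> AF
      T'.
  rewrite /AF => -> H /andP[_ /orP[] /has_keyP hk] /=; apply/orP; case: H => H.
  - by left; apply/has_keyP => m hm; rewrite H // hk.
  - by right; apply/has_keyP => m hm; rewrite H // hk // key_col_sact.
  - by right; apply/has_keyP => m hm; rewrite H // hk.
  - by left; apply/has_keyP => m hm; rewrite H // hk // -key_tog.
have AQ_rel (T T' : filling lam) : semistandard T' -> (forall m, 0 < m <= r ->
  rkey T' m = rkey T m) ->
    AQ T -> AQ T'.
  rewrite /AQ => -> H /andP[_ /has_keyP hk] /=.
  by apply/has_keyP => m hm; rewrite H // hk.
have AF_f (T : filling lam) : AF T -> 0 < phi i T -> AF (fop i T).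
  move=> hT h0; have sT : semistandard T by case/andP: hT.
  apply: AF_rel hT; first exact: fop_semistandard.
  by have [h|[_ h]] := rkey_fop hlam sT h0; [left | right].
have AF_e (T : filling lam) : AF T -> 0 < eps i T -> AF (eop i T).
  move=> hT h0; have sT : semistandard T by case/andP: hT.
  have sT' := eop_semistandard hlam sT h0.
  have h0' : 0 < phi i (eop i T) by rewrite phi_eop.
  apply: AF_rel hT => //; have := rkey_fop hlam sT' h0'; rewrite eopK //.
  case=> [h|[_ h]]; [left | right] => m hm; first by rewrite h.
  by rewrite h // toggleK.
have AQ_f (T : filling lam) : AQ T -> 0 < phi i T -> AQ (fop i T).
  move=> hT h0; have sT : semistandard T by case/andP: hT.
  apply: AQ_rel (hT); first exact: fop_semistandard.
  (* The key could change only at a highest element, and [epsQ] excludes this. *)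
  by have [//|[e0 _]] := rkey_fop hlam sT h0; have := epsQ T hT; rewrite e0.
have AQ_e (T : filling lam) : AQ T -> 1 < eps i T -> AQ (eop i T).
  move=> hT h1; have h0 := ltnW h1; have sT : semistandard T by case/andP: hT.
  have sT' := eop_semistandard hlam sT h0.
  have h0' : 0 < phi i (eop i T) by rewrite phi_eop.
  apply: AQ_rel (hT) => //; have := rkey_fop hlam sT' h0'; rewrite eopK //.
  case=> [h m hm|[e0 _]]; first by rewrite h.
  (* As [eps i T > 1], the tableau [eop i T] is still not highest, so the key is constant on this
     step. *)
  by have := eps_eop h0; rewrite e0 => e; rewrite -e in h1.
apply: rhobar_eq.
  have -> : (\sum_(T : filling lam | semistandard T && has_key tau T) weight T +
     \sum_(T : filling lam | semistandard T && has_key (sact i tau) T) weight T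
       =
     \sum_(T : filling lam | AF T) weight T)%R.
    rewrite [RHS](bigID (has_key tau)) /=; congr (_ + _)%R; apply: eq_bigl => T.
      by rewrite /AF; case: (has_key tau T); rewrite ?andbT ?andbF.
    rewrite /AF; have := sepk T; case: (has_key tau T) => [->|_] //;
      rewrite ?andbF //.
    by rewrite andbT.
  have := msym_string_sum hlam (A := AF) (delta := 0) _ _ AF_f AF_e.
  by rewrite expr0 mul1r; apply=> // T /andP[].
have := msym_string_sum hlam (A := AQ) (delta := 1) _ epsQ AQ_f AQ_e.
by rewrite expr1; apply=> T /andP[].
Qed.

End KeysOfPermutations.

Theorem corollary10p4 (n : nat) (lam : n.-tuple nat) (pi : 'S_n)
    (w : seq 'I_n.-1) (hn : 1 <= n) (hlam : is_partition lam)
    (hpi : in_Slam lam pi) (hw : reduced_composition pi w) :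
  atom lam w =
  (\sum_(T : filling lam | semistandard T &&
           [forall b : box lam,
              entry T (bcol b) (brow b) \in Cset T pi (bcol b) (brow b)])
      weight T)%R.
Proof.
rewrite (atom_has_key hlam hpi hw); apply: eq_bigl => T.
by case hT : (semistandard T) => //=; rewrite Cset_has_key.
Qed.
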